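(* Consider the triangular simultaneous equations model and fitted regressor matrix $\hat X$ described in the context. Assume: (i) the data $\{y_i,\mathbf{x}_i,\mathbf{z}_i\}_{i=1}^n$ are i.i.d. with finite second moments, $\mathbb{E}(\mathbf{z}_{ij}\epsilon_i)=\mathbb{E}(\mathbf{z}_{ij}\eta_{ij})=\mathbf{0}$ for all $j=1,\dots,p$, and $\mathbb{E}(\mathbf{z}_{ij}\eta_{ij'})=\mathbf{0}$ for all $j\neq j'$; (ii) $p$ and $d$ can grow with and exceed $n$; each $\pi_j^*$ has at most $k_1$ non-zero components and $\beta^*$ has at most $k_2$ non-zero components, where $k_1,k_2$ can increase to infinity with $n$ but slowly compared to $n$; (iii) $\epsilon$ and $\eta_j$ ($j=1,\dots,p$) are i.i.d. zero-mean sub-Gaussian vectors with parameters $\sigma_\epsilon^2$ and $\sigma_\eta^2$ respectively, and $Z_j$ is a sub-Gaussian matrix with parameters $(\Sigma_{Z_j},\sigma_Z^2)$ for each $j$; (iv) $X^*$ is a sub-Gaussian matrix with parameters $(\Sigma_{X^*},\sigma_{X^*}^2)$; (v) the first-stage estimator satisfies $\max_{j}|\hat\pi_j-\pi_j^*|_1\le \frac{c\sigma_\eta}{\lambda_{\min}(\Sigma_Z)}k_1\sqrt{\frac{\log\max(d,p)}{n}}$ with probability at least $1-c_1\exp(-c_2\log\max(d,p,n))$ for some universal constants $c,c_1,c_2$; (vi) $n\succsim\max\{k_1^2\log d,\ k_1^2\log p\}$. Then, for some universal constants $c,c_1,c_2$, with probability at least $1-c_1\exp(-c_2\log\max(p,d))$,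 $$\frac{|\hat Xv^0|_2^2}{n}\ge\kappa_1|v^0|_2^2-c\,\kappa_2k_1\sqrt{\frac{\log\max(p,d)}{n}}\,|v^0|_1^2\qquad\text{for all }v^0\in\mathbb{R}^p,$$ where $\kappa_1=\frac{\lambda_{\min}(\Sigma_{X^*})}{2}$, $\kappa_2=\max\{b_0,b_1,b_2\}$, $$b_0=\lambda_{\min}(\Sigma_{X^*})\max\left\{\frac{\sigma_{X^*}^4}{\lambda_{\min}^2(\Sigma_{X^*})},1\right\},$$ $$b_1=\max\left\{\frac{\sigma_\eta\max_{j',j}|\mathbb{E}(x^*_{ij'}\mathbf{z}_{ij})|_\infty}{\lambda_{\min}(\Sigma_Z)},\ \frac{\sigma_\eta\sigma_{X^*}\sigma_Z}{\lambda_{\min}(\Sigma_Z)}\right\},$$ $$b_2=\max\left\{\frac{\sigma_\eta^2\max_{j',j}|\mathbb{E}(\mathbf{z}_{ij'}\mathbf{z}_{ij}^T)|_\infty}{\lambda_{\min}^2(\Sigma_Z)},\ \frac{\sigma_\eta^2\sigma_Z^2}{\lambda_{\min}^2(\Sigma_Z)}\right\}.$$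
   Context: Notation: $|v|_q$ is the $l_q$ norm of a vector; for a vector or matrix, $|\cdot|_\infty$ is the maximum absolute entry. $\lambda_{\min}$ is the minimum eigenvalue. $f\succsim g$ means $f\ge cg$ for a universal constant $c\in(0,\infty)$. Sub-Gaussian: a random variable $U$ with mean $\mu$ is sub-Gaussian with parameter $\sigma^2$ if $\mathbb{E}[\exp(t(U-\mu))]\le\exp(\sigma^2t^2/2)$ for all $t\in\mathbb{R}$. A random matrix $A\in\mathbb{R}^{n\times m}$ is sub-Gaussian with parameters $(\Sigma_A,\sigma_A^2)$ if its rows are sampled independently from a zero-mean distribution on $\mathbb{R}^m$ with covariance $\Sigma_A$ and, for any unit vector $u\in\mathbb{R}^m$, the inner product of $u$ with each row is sub-Gaussian with parameter at most $\sigma_A^2$. Model: for $i=1,\dots,n$, $y_i=\mathbf{x}_i^T\beta^*+\epsilon_i$ with $\mathbf{x}_i,\beta^*\in\mathbb{R}^p$, and $x_{ij}=\mathbf{z}_{ij}^T\pi_j^*+\eta_{ij}$ for $j=1,\dots,p$ with $\mathbf{z}_{ij},\pi_j^*\in\mathbb{R}^{d_j}$; $\epsilon_i,\eta_{ij}$ are zero-mean errors; $\mathbf{z}_i$ collects $\mathbf{z}_{i1},\dots,\mathbf{z}_{ip}$. Stack: $\epsilon\in\mathbb{R}^n$; $\eta_j=(\eta_{1j},\dots,\eta_{nj})^T$; $Z_j\in\mathbb{R}^{n\times d_j}$ has rows $\mathbf{z}_{ij}^T$. $X^*\in\mathbb{R}^{n\times p}$ has $j$th column $Z_j\pi_j^*$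 and entries $x^*_{ij}$. Given first-stage estimates $\hat\pi_j$ of $\pi_j^*$, $\hat X\in\mathbb{R}^{n\times p}$ has columns $\hat{\mathbf{x}}_j=Z_j\hat\pi_j$. $\lambda_{\min}(\Sigma_Z)=\min_j\lambda_{\min}(\Sigma_{Z_j})$. Standing conventions: $(y_i,\mathbf{x}_i,\mathbf{z}_i)$ have mean zero; $d_j=d$ for all $j$; $p\ge n$ and $d\ge n$. *)

(* Defs.v *)
From HB Require Import structures.
From mathcomp Require Import all_boot all_order all_algebra.
From mathcomp Require Import all_classical all_reals all_analysis.

Set Implicit Arguments.
Unset Strict Implicit.
Unset Printing Implicit Defensive.

Import Order.TTheory GRing.Theory Num.Theory.
Import numFieldNormedType.Exports.

Local Open Scope classical_set_scope.
Local Open Scope ring_scope.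

Section linear_algebra.
Context {R : realType}.

Definition l1norm m (v : 'cV[R]_m) : R := \sum_k `|v k 0|.

Definition l2norm m (v : 'cV[R]_m) : R := Num.sqrt (\sum_k v k 0 ^+ 2).

Definition nnz m (v : 'cV[R]_m) : nat := #|[set k | v k 0 != 0]%SET|.

(* For a symmetric matrix of size m > 0 this set is finite and nonempty, so the
   infimum is attained. *)
Definition lambda_min m (A : 'M[R]_m) : R := inf [set a | eigenvalue A a].

End linear_algebra.

Section random.
Context {disp : measure_display} {T : measurableType disp} {R : realType}.
Variable P : probability T R.

Definition mutually_independent disp' (T' : measurableType disp') n
    (W : 'I_n -> T -> T') : Prop :=
  forall (J : {set 'I_n}) (B : 'I_n -> set T'), (forall i, measurable (B i)) ->
    P (\bigcap_(i in [set i | i \in J]) (W i @^-1` B i)) =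
    (\prod_(i in J) P (W i @^-1` B i))%E.

Definition identically_distributed disp' (T' : measurableType disp') n
    (W : 'I_n -> T -> T') : Prop :=
  forall (i j : 'I_n) (B : set T'), measurable B ->
    P (W i @^-1` B) = P (W j @^-1` B).

Definition iid disp' (T' : measurableType disp') n (W : 'I_n -> T -> T') :
    Prop :=
  [/\ forall i, measurable_fun setT (W i), mutually_independent W &
      identically_distributed W].

(* The parameter s2 is the variance proxy, sigma^2 in the usual notation. *)
Definition sub_gaussian (U : T -> R) (s2 : R) : Prop :=
  P.-integrable setT (EFin \o U) /\
  forall t : R, ('E_P[fun w => expR (t * (U w - fine ('E_P[U])%E))]
                 <= (expR (s2 * t ^+ 2 / 2))%:E)%E.

Definition sub_gaussian_vector n (U : 'I_n -> T -> R) (s2 : R) : Prop :=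
  [/\ iid U, forall i, ('E_P[U i] = 0)%E & forall i, sub_gaussian (U i) s2].

Definition sub_gaussian_matrix n m (A : T -> 'M[R]_(n, m)) (Sigma : 'M[R]_m)
    (s2 : R) : Prop :=
  [/\ iid (fun i w => [tuple A w i k | k < m]),
      forall i k, ('E_P[fun w => A w i k] = 0)%E,
      forall i k l,
        covariance P (fun w => A w i k) (fun w => A w i l) = (Sigma k l)%:E &
      forall i (u : 'cV[R]_m), l2norm u = 1 ->
        exists2 s : R, s <= s2 & sub_gaussian (fun w => (A w *m u) i 0) s].

End random.

Section model.
Context {T : Type} {R : realType} {n p d : nat}.
Implicit Types (z : 'I_n -> 'I_p -> 'I_d -> T -> R) (pi : 'I_p -> 'cV[R]_d).

(* z i j l is the l-th coordinate of the j-th instrument vector of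
   observation i. *)
Definition Zmx z (j : 'I_p) (w : T) : 'M[R]_(n, d) := \matrix_(i, l) z i j l w.

(* The matrix whose j-th column is Z_j pi_j: this is X^* when pi is the true
   first-stage coefficient and the fitted \hat X when pi is its estimate. *)
Definition first_stage z pi (w : T) : 'M[R]_(n, p) :=
  \matrix_(i, j) (Zmx z j w *m pi j) i 0.

Definition obs (y : 'I_n -> T -> R) (x : 'I_n -> 'I_p -> T -> R) z
    (i : 'I_n) (w : T) : R * p.-tuple R * p.-tuple (d.-tuple R) :=
  (y i w, [tuple x i j w | j < p], [tuple [tuple z i j l w | l < d] | j < p]).

End model.

Section constants.
Context {disp : measure_display} {T : measurableType disp} {R : realType}.
Context {n p d : nat}.
Variable P : probability T R.
Variables (z : 'I_n -> 'I_p -> 'I_d -> T -> R) (pistar : 'I_p -> 'cV[R]_d).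
(* Observation at which the population moments are evaluated; its choice is
   immaterial for identically distributed data. *)
Variable i : 'I_n.

(* In both maxima below the outer bars are the matrix norm, i.e., the maximum
   absolute entry. *)
Definition max_Exz : R :=
  \big[Num.max/0]_(j' < p) \big[Num.max/0]_(j < p)
    `| \col_(l < d)
         fine ('E_P[fun w => (first_stage z pistar w i j' * z i j l w)%R])%E |.

Definition max_Ezz : R :=
  \big[Num.max/0]_(j' < p) \big[Num.max/0]_(j < p)
    `| \matrix_(l < d, l' < d) fine ('E_P[fun w => (z i j' l w * z i j l' w)%R])%E |.

End constants.

Section kappas.
Context {R : realType}.
Implicit Types lamX lamZ sX sZ s_eta : R.

Definition b0 lamX sX : R := lamX * Num.max (sX ^+ 4 / lamX ^+ 2) 1.

Definition b1 lamZ sX sZ s_eta (Exz : R) : R :=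
  Num.max (s_eta * Exz / lamZ) (s_eta * sX * sZ / lamZ).

Definition b2 lamZ sZ s_eta (Ezz : R) : R :=
  Num.max (s_eta ^+ 2 * Ezz / lamZ ^+ 2) (s_eta ^+ 2 * sZ ^+ 2 / lamZ ^+ 2).

End kappas.

(* Main.v *)
Require Import Defs.
From HB Require Import structures.
From mathcomp Require Import all_boot all_order all_algebra.
From mathcomp Require Import all_classical all_reals all_analysis.
From mathcomp Require Import measurable_realfun.
From mathcomp Require Import ring lra.

Set Implicit Arguments.
Unset Strict Implicit.
Unset Printing Implicit Defensive.

Import Order.TTheory GRing.Theory Num.Theory.
Import numFieldNormedType.Exports.

Local Open Scope classical_set_scope.
Local Open Scope ring_scope.

(** The matrix [X^] is a small perturbation [X* + D] of [X*], where the
entries of [D] are [z_ij . (pi^_j - pi*_j)].  Since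
[|X^ v|^2 >= |X* v|^2 + 2 <X* v, D v>], two entrywise estimates suffice: if the
entries of [X*^T X* / n - SigmaX] are at most [eps] and those of [X*^T D / n]
at most [rho] in absolute value, then
[|X^ v|^2 / n >= lambda_min(SigmaX) |v|_2^2 - (eps + 2 rho) |v|_1^2]
([restricted_eigenvalue_perturb]).

Write [L = ln (max p d)] and [delta = sqrt (L / n)].

- [eps] is of order [s_X^2 delta], and [s_X^2 <= b0].  The product of two
  entries of a row of a sub-Gaussian matrix has absolute moments of order [q]
  at most [q! K^q] with [K = 2 e s_X^2], because the even moments of a
  sub-Gaussian variable grow like those of a Gaussian
  ([sub_gaussian_even_moment]).  This factorial growth bounds the moment
  generating function near the origin ([bernstein_mgf]); independence of the
  rows and the exponential Markov inequality then bound the deviation of each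
  empirical moment ([bernstein_tail], [gram_tail]), and a union bound treats all
  entries at once ([gram_uniform_deviation]).  The condition [c_n L <= n],
  which is what the sample size assumption says once [k1 >= 1], keeps the
  exponential parameter in the range where the bound is valid.
- [rho] is at most the largest [|n^-1 sum_i x*_ij z_ij'l|] times the
  largest [|pi^_j - pi*_j|_1].  The first factor is of order [s_X s_Z] because
  the empirical second moments of the entries of [X*] and of the [Z_j] are
  ([cross_moment_le]); the second one is controlled by the first stage.  Their
  product is of order [b1 k1 delta].

The boundary cases are degenerate.  When [lambda_min(SigmaX) <= 0] the right-hand
side is nonpositive; [k1 = 0] and [s_X = 0] both lead there.  When
[lambda_min(SigmaZ) <= 0] the first-stage bound forces [D = 0].

Probabilities are only monotone on measurable sets, so the event of the
conclusion, an intersection over all real vectors, is rewritten as a countable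
intersection over rational ones ([measurable_restricted_eigenvalue]). *)

(** * Expectation of products of independent variables *)

Section independence.
Context {disp : measure_display} {T : measurableType disp} {R : realType}
  (P : probability T R).
Import HBNNSimple.
Local Open Scope ereal_scope.

(** If the factorization holds for indicators of the second factor, it holds for
all nonnegative functions: both sides are linear and continuous along
increasing sequences of simple functions. *)
Lemma integralM_of_indic d' (T' : measurableType d') (W : T -> T')
    (g : T -> R) (c : R) (f : T' -> R) :
  measurable_fun [set: T] W -> measurable_fun [set: T] g ->
  (forall w, 0 <= g w)%R -> (0 <= c)%R ->
  (forall B, measurable B ->
    \int[P]_w (g w * \1_B (W w))%:E = c%:E * P (W @^-1` B)) ->
  measurable_fun [set: T'] f -> (forall v, 0 <= f v)%R ->
  \int[P]_w (g w * f (W w))%:E = c%:E * \int[P]_w (f (W w))%:E.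
Proof.
move=> mW mg g0 c0 gB mf f0.
have mEf : measurable_fun [set: T'] (EFin \o f) by exact/measurable_EFinP.
pose h := nnsfun_approx measurableT mEf.
have nd k l w : (k <= l)%N -> (h k w <= h l w)%R.
  by move=> kl; have /lefP := nd_nnsfun_approx measurableT mEf kl; apply.
have hf w : (h k w)%:E @[k --> \oo] --> (f w)%:E.
  by apply: (@cvg_nnsfun_approx _ _ _ _ measurableT _ mEf) => // v _; rewrite lee_fin.
have mh k : measurable_fun setT (fun w => h k (W w)) by exact: measurableT_comp.
have mB k r : measurable (h k @^-1` [set r]).
  by rewrite -[X in measurable X]setTI; exact: measurable_funPT.
have m1 k r : measurable_fun [set: T] (fun w => \1_(h k @^-1` [set r]) (W w) : R).
  by apply: measurableT_comp mW; exact: measurable_indic.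
have r0 k r : r \in range (h k) -> (0 <= r)%R by rewrite inE => -[v _ <-].
have ge0 k r w : (0 <= r * \1_(h k @^-1` [set r]) (W w))%R.
  rewrite indicE; case: (boolP (W w \in _)) => [|_]; last by rewrite mulr0.
  by rewrite inE/= => <-; rewrite mulr1.
have stepE k w : (h k (W w))%:E =
    \sum_(r \in range (h k)) (r * \1_(h k @^-1` [set r]) (W w))%:E.
  by rewrite fimfunE -fsumEFin.
have step k : \int[P]_w (g w * h k (W w))%:E = c%:E * \int[P]_w (h k (W w))%:E.
  have -> : \int[P]_w (h k (W w))%:E =
      \sum_(r \in range (h k)) r%:E * P (W @^-1` (h k @^-1` [set r])).
    under eq_integral do rewrite stepE.
    rewrite ge0_integral_fsum//.
    - apply: eq_fsbigr => r /r0 rge0.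
      under eq_integral do rewrite EFinM.
      rewrite ge0_integralZl//.
        congr (_ * _).
        rewrite -[LHS]/(\int[P]_w (\1_(W @^-1` (h k @^-1` [set r])) w)%:E).
        rewrite integral_indic ?setIT// -[X in measurable X]setTI.
        exact: mW.
      exact/measurable_EFinP.
    - by move=> r; apply/measurable_EFinP; exact: measurable_funM.
    - by move=> r w _; rewrite lee_fin.
  rewrite ge0_mule_fsumr; last first.
    move=> r; have [/r0 rge0|] := boolP (r \in range (h k)).
      by rewrite mule_ge0// lee_fin.
    rewrite notin_setE => nr.
    rewrite (_ : h k @^-1` [set r] = set0) ?preimage_set0 ?measure0 ?mule0//.
    by apply/seteqP; split => // v /= hv; apply: nr; exists v.
  transitivity (\int[P]_w \sum_(r \in range (h k))
      (r * (g w * \1_(h k @^-1` [set r]) (W w)))%:E).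
    apply: eq_integral => w _; rewrite EFinM stepE ge0_mule_fsumr//.
      by apply: eq_fsbigr => r _; rewrite -EFinM mulrCA.
    by move=> r; rewrite lee_fin.
  rewrite ge0_integral_fsum//; last 2 first.
    - move=> r; apply/measurable_EFinP; apply: measurable_funM => //.
      exact: measurable_funM.
    - by move=> r w _; rewrite lee_fin mulrCA mulr_ge0.
  apply: eq_fsbigr => r /r0 rge0.
  under eq_integral do rewrite EFinM.
  rewrite ge0_integralZl//; last 2 first.
    - by apply/measurable_EFinP; exact: measurable_funM.
    - by move=> w _; rewrite lee_fin mulr_ge0.
  by rewrite gB// muleCA.
have L : (\int[P]_w (g w * h k (W w))%:E) @[k --> \oo] -->
    \int[P]_w (g w * f (W w))%:E.
  have -> : \int[P]_w (g w * f (W w))%:E =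
      \int[P]_w limn (fun k => (g w * h k (W w))%:E).
    apply: eq_integral => w _; apply/esym/cvg_lim => //.
    under eq_fun do rewrite EFinM.
    by rewrite EFinM; apply: cvgeZl.
  apply: cvg_monotone_convergence => //.
  - by move=> k; apply/measurable_EFinP; exact: measurable_funM.
  - by move=> k w _; rewrite lee_fin mulr_ge0.
  - by move=> w _ k l kl; rewrite lee_fin ler_wpM2l// nd.
have L' : (\int[P]_w (h k (W w))%:E) @[k --> \oo] --> \int[P]_w (f (W w))%:E.
  have -> : \int[P]_w (f (W w))%:E =
      \int[P]_w limn (fun k => (h k (W w))%:E).
    by apply: eq_integral => w _; apply/esym/cvg_lim.
  apply: cvg_monotone_convergence => //.
  - by move=> k; apply/measurable_EFinP.
  - by move=> k w _; rewrite lee_fin.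
  - by move=> w _ k l kl; rewrite lee_fin nd.
rewrite -(cvg_lim _ L)//; under eq_fun do rewrite step.
by apply/cvg_lim => //; apply: cvgeZl.
Qed.

(** Independence is the case where every [f i] is an indicator;
[integralM_of_indic] replaces the indicators by arbitrary functions. *)
Lemma integral_prod_independent d' (T' : measurableType d') n
    (W : 'I_n -> T -> T') (f : 'I_n -> T' -> R) (c : 'I_n -> R) :
  (forall i, measurable_fun setT (W i)) -> mutually_independent P W ->
  (forall i, measurable_fun setT (f i)) -> (forall i v, 0 <= f i v)%R ->
  (forall i, \int[P]_w (f i (W i w))%:E = (c i)%:E) ->
  \int[P]_w (\prod_i f i (W i w))%:E = (\prod_i c i)%:E.
Proof.
move=> mW indW.
have PWfin i B : measurable B -> P (W i @^-1` B) \is a fin_num.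
  move=> mB; apply: fin_num_measure.
  by rewrite -[X in measurable X]setTI; exact: mW.
(* Induction on the number [k] of initial coordinates whose function is
   arbitrary, the other functions being indicators. *)
suff H k : forall (f : 'I_n -> T' -> R) (c : 'I_n -> R),
    (forall i, measurable_fun setT (f i)) -> (forall i v, 0 <= f i v)%R ->
    (forall i, \int[P]_w (f i (W i w))%:E = (c i)%:E) ->
    (forall i : 'I_n, (k <= i)%N -> exists2 B, measurable B & f i = \1_B) ->
    \int[P]_w (\prod_i f i (W i w))%:E = (\prod_i c i)%:E.
  by move=> mf f0 fc; apply: (H n) => // i; rewrite leqNgt ltn_ord.
elim: k => [|k IH] {}f {}c mf f0 fc fB.
  have {fB} /choice[B fB] : forall i, exists B, measurable B /\ f i = \1_B.
    by move=> i; have [//|B mB ->] := fB i; exists B.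
  have mB i : measurable (B i) by case: (fB i).
  have fE i : f i = \1_(B i) by case: (fB i).
  have mWB i : measurable (W i @^-1` B i).
    by rewrite -[X in measurable X]setTI; exact: mW.
  have cE i : (c i)%:E = P (W i @^-1` B i).
    by rewrite -fc fE -[LHS]/(\int[P]_w (\1_(W i @^-1` B i) w)%:E) integral_indic ?setIT.
  have := indW [set: 'I_n]%SET B mB.
  rewrite [X in _ = X -> _](eq_bigl xpredT) => [|i]; last by rewrite finset.in_setT.
  rewrite -prodEFin (eq_bigr _ (fun i _ => cE i)) => <-.
  transitivity (\int[P]_w
    (\1_(\bigcap_(i in [set i | i \in [set: 'I_n]%SET]) (W i @^-1` B i)) w)%:E).
    apply: eq_integral => w _; congr EFin.
    rewrite indicE; case: (boolP (w \in _)) => [|wB].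
      rewrite inE => wB; rewrite big1// => i _; rewrite fE indicE mem_set//.
      by apply: wB => /=; rewrite finset.in_setT.
    have [i Wi] : exists i, ~ B i (W i w).
      apply: contrapT => h; case/negP: wB; rewrite inE => i _.
      by apply: contrapT => Bi; apply: h; exists i.
    by rewrite (bigD1 i)//= fE indicE memNset ?mul0r.
  rewrite integral_indic ?setIT//.
  by apply: fin_bigcap_measurable.
have [kn|nk] := ltnP k n; last first.
  by apply: IH => // i ki; have := ltn_ord i; rewrite ltnNge (leq_trans nk).
pose i0 := Ordinal kn.
pose g w := (\prod_(i | i != i0) f i (W i w))%R.
have EM w : (\prod_i f i (W i w) = g w * f i0 (W i0 w))%R.
  by rewrite (bigD1 i0)//= mulrC.
under eq_integral do rewrite EM.
have c0 i : (0 <= c i)%R.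
  by rewrite -lee_fin -fc integral_ge0// => w _; rewrite lee_fin.
rewrite (@integralM_of_indic _ _ (W i0) g (\prod_(i | i != i0) c i))//.
- by rewrite fc -EFinM [in RHS](bigD1 i0)//= mulrC.
- rewrite (_ : g = fun w => \prod_i (if i != i0 then f i (W i w) else 1))%R.
    apply: (@measurable_prod _ _ _ _ _ _
      (fun i w => if i != i0 then f i (W i w) else 1%R)) => i _.
    by case: (i != i0) => // _; exact: measurableT_comp.
  by apply/funext => w; rewrite /g big_mkcond.
- by move=> w; apply: prodr_ge0.
- by apply: prodr_ge0.
move=> B mB.
pose f' i := if i == i0 then \1_B else f i.
pose c' i := if i == i0 then fine (P (W i0 @^-1` B)) else c i.
have -> : \int[P]_w (g w * \1_B (W i0 w))%:E =
    \int[P]_w (\prod_i f' i (W i w))%:E.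
  apply: eq_integral => w _; congr EFin.
  rewrite [RHS](bigD1 i0)//= {1}/f' eqxx mulrC; congr (_ * _)%R.
  by apply: eq_bigr => i /negPf ii0; rewrite /f' ii0.
rewrite (IH f' c').
- rewrite (bigD1 i0)//= {1}/c' eqxx mulrC EFinM fineK ?PWfin//.
  congr (_%:E * _); apply: eq_bigr => i /negPf ii0; by rewrite /c' ii0.
- by move=> i; rewrite /f'; case: eqP => // _; exact: measurable_indic.
- by move=> i v; rewrite /f'; case: eqP.
- move=> i; rewrite /f' /c'; case: eqP => [->|//]; rewrite fineK ?PWfin//.
  rewrite -[LHS]/(\int[P]_w (\1_(W i0 @^-1` B) w)%:E) integral_indic ?setIT//.
  by rewrite -[X in measurable X]setTI; exact: mW.
- move=> i ki; rewrite /f'; case: eqP => [_|/eqP ii0]; first by exists B.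
  by apply: fB; rewrite ltn_neqAle ki andbT eq_sym -val_eqE in ii0 *.
Qed.

End independence.

(** * Moments and exponential moments *)

Lemma fact_double_le k : ((2 * k)`! <= k`! * (2 * k) ^ k)%N.
Proof.
rewrite -(@ffact_fact (2 * k) k); last by rewrite mul2n -addnn leq_addr.
rewrite mul2n -addnn addnK mulnC leq_mul2l; apply/orP; right.
rewrite ffact_prod -[X in (_ <= _ ^ X)%N]card_ord -prod_nat_const.
by rewrite leq_prod// => i _; rewrite leq_subr.
Qed.

Section moments.
Context {disp : measure_display} {T : measurableType disp} {R : realType}
  (P : probability T R).

(** Since [|t U|^(2k) / (2k)! <= exp |t U| <= exp (t U) + exp (- t U)], each [t]
bounds the moment by [2 (2k)! t^(-2k) exp (s t^2 / 2)].  The choice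
[t^2 = 2k / s] is optimal, and [(2k)! <= k! (2k)^k] leaves a single factorial. *)
Lemma sub_gaussian_even_moment (U : T -> R) (s : R) (k : nat) :
  measurable_fun setT U -> 0 < s -> (0 < k)%N ->
  (forall t, \int[P]_w (expR (t * U w))%:E <= (expR (s * t ^+ 2 / 2))%:E)%E ->
  (\int[P]_w (U w ^+ (2 * k))%:E <= (k`!%:R * (2 * expR 1 * s) ^+ k)%:E)%E.
Proof.
move=> mU s0 k0 mgf.
have kR : 0 < k%:R :> R by rewrite ltr0n.
pose t := Num.sqrt (2 * k%:R / s).
have t2 : t ^+ 2 = 2 * k%:R / s.
  by rewrite sqr_sqrtr// divr_ge0 ?ltW// mulr_gt0.
have t2k : t ^+ (2 * k) = (2 * k%:R / s) ^+ k by rewrite exprM t2.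
have t0 : 0 < t by rewrite sqrtr_gt0 divr_gt0// mulr_gt0.
pose C := (2 * k)`!%:R / t ^+ (2 * k).
have C0 : 0 <= C by rewrite divr_ge0// exprn_ge0// ltW.
have mE r : measurable_fun setT (fun w => (expR (r * U w))%:E : \bar R).
  by apply/measurable_EFinP; apply: measurableT_comp => //; exact: measurable_funM.
have ptw w : U w ^+ (2 * k) <= C * (expR (t * U w) + expR (- t * U w)).
  have -> : U w ^+ (2 * k) = `|U w| ^+ (2 * k).
    by rewrite !exprM -normrX ger0_norm// sqr_ge0.
  have A : (t * `|U w|) ^+ (2 * k) / (2 * k)`!%:R <= expR (t * `|U w|).
    have [m ->] : exists m, (2 * k)%N = m.+1.
      by exists (2 * k).-1; rewrite prednK// muln_gt0.
    apply: le_trans (expR_ge1Dxn m _); first by rewrite lerDr.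
    by rewrite mulr_ge0// ltW.
  have B : expR (t * `|U w|) <= expR (t * U w) + expR (- t * U w).
    have [U0|U0] := leP 0 (U w).
      by rewrite (ger0_norm U0) lerDl expR_ge0.
    by rewrite (ltr0_norm U0) mulrN -mulNr lerDr expR_ge0.
  rewrite /C mulrAC ler_pdivlMr ?exprn_gt0// mulrC -exprMn.
  rewrite -ler_pdivrMl ?ltr0n ?fact_gt0// mulrC.
  exact: le_trans A B.
apply: (@le_trans _ _ (\int[P]_w (C%:E * ((expR (t * U w))%:E + (expR (- t * U w))%:E)))%E).
  apply: ge0_le_integral => //.
  - by move=> w _; rewrite lee_fin exprM exprn_ge0// sqr_ge0.
  - by apply/measurable_EFinP; exact: measurable_funX.
  - by apply: measurable_funeM; exact: emeasurable_funD.
  - by move=> w _; rewrite -EFinD -EFinM lee_fin.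
rewrite ge0_integralZl//; last 2 first.
  - exact: emeasurable_funD.
  - by move=> w _; rewrite -EFinD lee_fin addr_ge0// expR_ge0.
rewrite ge0_integralD//; try by move=> w _; rewrite lee_fin expR_ge0.
have M2 : (\int[P]_w (expR (t * U w))%:E + \int[P]_w (expR (- t * U w))%:E
    <= (expR 1 ^+ k * 2)%:E)%E.
  have ek : expR (s * t ^+ 2 / 2) = expR 1 ^+ k :> R.
    by rewrite -expRM_natl; congr expR; rewrite t2; field; rewrite gt_eqF.
  rewrite mulr_natr mulr2n EFinD -ek; apply: leeD; first exact: mgf.
  by rewrite -(sqrrN t); exact: mgf.
apply: (@le_trans _ _ (C%:E * (expR 1 ^+ k * 2)%:E)%E).
  by apply: lee_wpmul2l M2; rewrite lee_fin.
rewrite -EFinM lee_fin /C t2k.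
have F : (2 * k)`!%:R <= k`!%:R * (2 * k%:R) ^+ k :> R.
  by rewrite -natrM -natrX -natrM ler_nat fact_double_le.
apply: (@le_trans _ _ (k`!%:R * (2 * k%:R) ^+ k / (2 * k%:R / s) ^+ k * (expR 1 ^+ k * 2))).
  rewrite ler_wpM2r//.
  by rewrite ler_wpM2r// invr_ge0 exprn_ge0// divr_ge0 ?mulr_ge0// ltW.
rewrite [leLHS](_ : _ = k`!%:R * (expR 1 * s) ^+ k * 2); last first.
  rewrite expr_div_n (exprMn k (expR 1)); field.
  by rewrite !expf_neq0// ?mulf_neq0// gt_eqF.
rewrite [leRHS](_ : _ = k`!%:R * (expR 1 * s) ^+ k * 2 ^+ k); last first.
  by rewrite -(mulrA 2) (exprMn k 2); ring.
rewrite ler_wpM2l//.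
  by rewrite mulr_ge0// exprn_ge0// mulr_ge0 ?expR_ge0// ltW.
by rewrite -[leLHS]expr1 ler_weXn2l// ler1n.
Qed.

End moments.

Lemma geometric_tail_le (R : realType) (r : R) n : 0 <= r <= 1 / 2 ->
  \sum_(0 <= k < n) r ^+ (k + 2) <= 2 * r ^+ 2.
Proof.
move=> /andP[r0 r12]; apply: (@le_trans _ _ (2 * r ^+ 2 - 2 * r ^+ (n + 2))); last first.
  by rewrite gerBl mulr_ge0// exprn_ge0.
elim: n => [|n IH]; first by rewrite big_nil subrr.
rewrite big_nat_recr//= (le_trans (lerD IH (lexx _)))// addSn (exprS r (n + 2)).
have := ler_wpM2r (exprn_ge0 (n + 2) r0) r12; lra.
Qed.

Section bernstein.
Context {disp : measure_display} {T : measurableType disp} {R : realType}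
  (P : probability T R).

(** Arithmetic-geometric mean: [|U V|^k <= (U^(2k) + V^(2k)) / 2]. *)
Lemma moment_mul_le (U V : T -> R) (k : nat) (A : R) :
  measurable_fun setT U -> measurable_fun setT V ->
  (\int[P]_w (U w ^+ (2 * k))%:E <= A%:E)%E ->
  (\int[P]_w (V w ^+ (2 * k))%:E <= A%:E)%E ->
  (\int[P]_w (`|U w * V w| ^+ k)%:E <= A%:E)%E.
Proof.
move=> mU mV UA VA.
have even_ge0 (x : R) : 0 <= x ^+ (2 * k) by rewrite exprM exprn_ge0// sqr_ge0.
have evenE (x : R) : x ^+ (2 * k) = (`|x| ^+ k) ^+ 2.
  by rewrite exprM -(real_normK (num_real x)) -!exprM mulnC.
have mX (X : T -> R) : measurable_fun setT X ->
    measurable_fun setT (fun w => (X w ^+ (2 * k))%:E : \bar R).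
  by move=> mX; apply/measurable_EFinP; exact: measurable_funX.
apply: (@le_trans _ _ (\int[P]_w ((1 / 2)%:E * ((U w ^+ (2 * k))%:E + (V w ^+ (2 * k))%:E)))%E).
  apply: ge0_le_integral => //.
  - apply/measurable_EFinP/measurable_funX/measurableT_comp => //.
    exact: measurable_funM.
  - by apply: measurable_funeM; apply: emeasurable_funD; exact: mX.
  - move=> w _; rewrite -EFinD -EFinM lee_fin !evenE normrM exprMn.
    have := sqr_ge0 (`|U w| ^+ k - `|V w| ^+ k); nra.
rewrite ge0_integralZl//; last 2 first.
  - by apply: emeasurable_funD; exact: mX.
  - by move=> w _; rewrite -EFinD lee_fin addr_ge0.
have mUk := mX _ mU; have mVk := mX _ mV.
rewrite ge0_integralD//; try by move=> w _; rewrite lee_fin.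
apply: (@le_trans _ _ ((1 / 2)%:E * (A%:E + A%:E))%E).
  by apply: lee_wpmul2l; [rewrite lee_fin|exact: leeD].
by rewrite -EFinD -EFinM lee_fin; lra.
Qed.

(** An extended-real series, in order to be integrated term by term by monotone
convergence. *)
Lemma expR_taylor2_le (x : R) :
  ((expR x - 1 - x)%:E <= \sum_(0 <= k <oo) (`|x| ^+ (k + 2) / (k + 2)`!%:R)%:E)%E.
Proof.
set L := (\sum_(0 <= k <oo) _)%E.
have g0 k : 0 <= `|x| ^+ (k + 2) / (k + 2)`!%:R :> R.
  by rewrite divr_ge0// exprn_ge0.
have partial n : ((series (exp_coeff x) (n + 2)%N - 1 - x)%:E <= L)%E.
  apply: (@le_trans _ _ (\sum_(0 <= k < n) (`|x| ^+ (k + 2) / (k + 2)`!%:R)%:E)%E).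
    rewrite sumEFin lee_fin addn2 /series /= big_nat_recl// big_nat_recl//.
    rewrite /exp_coeff/= !expr0 !expr1 !divr1 [1 + _]addrC addrK.
    rewrite [x + _]addrC addrK.
    apply: ler_sum => k _.
    by rewrite addn2 ler_wpM2r ?invr_ge0// -normrX ler_norm.
  by apply: nneseries_lim_ge => k _ _; rewrite lee_fin.
case: L partial => [L| |] partial; last 2 first.
- by rewrite leey.
- by have := partial 0%N.
rewrite lee_fin lerBlDr lerBlDr /expR.
apply: limr_le; first exact: is_cvg_series_exp_coeff.
near=> n; have n2 : (2 <= n)%N by near: n; exists 2%N.
by rewrite -lerBlDr -lerBlDr -lee_fin -(subnK n2).
Unshelve. all: by end_near. Qed.

(** The terms of order at least two of [E exp (l W)] are dominated by the geometric
series of [(|l| K)^k], hence [E exp (l W) <= 1 + l m + 2 (l K)^2]; then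
[1 + x <= exp x]. *)
Lemma bernstein_mgf (W : T -> R) (K l m : R) :
  measurable_fun setT W -> 0 <= K ->
  (forall k, (0 < k)%N -> \int[P]_w (`|W w| ^+ k)%:E <= (k`!%:R * K ^+ k)%:E)%E ->
  (\int[P]_w (W w)%:E = m%:E)%E -> `|l| * K <= 1 / 2 ->
  (\int[P]_w (expR (l * (W w - m)))%:E <= (expR (2 * (l * K) ^+ 2))%:E)%E.
Proof.
move=> mW K0 mom Wm lK.
have mlW : measurable_fun setT (fun w => l * W w) by exact: measurable_funM.
pose h w := expR (l * W w) - 1 - l * W w.
have h0 w : 0 <= h w by rewrite /h -addrA -opprD subr_ge0 expR_ge1Dx.
have mh : measurable_fun setT h.
  apply: measurable_funB => //; apply: measurable_funB => //.
  exact: measurableT_comp.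
have intW : P.-integrable setT (EFin \o W).
  apply/integrableP; split; first exact/measurable_EFinP.
  have := mom 1%N isT; under eq_integral do rewrite expr1.
  by move=> /le_lt_trans; apply; rewrite ltry.
have ih : (\int[P]_w (h w)%:E <= (2 * (l * K) ^+ 2)%:E)%E.
  apply: (@le_trans _ _ (\int[P]_w \sum_(0 <= k <oo) (`|l * W w| ^+ (k + 2) / (k + 2)`!%:R)%:E)%E).
    apply: ge0_le_integral => //.
    - by move=> w _; rewrite lee_fin.
    - exact/measurable_EFinP.
    - apply: (@ge0_emeasurable_sum _ _ _ _
        (fun k w => (`|l * W w| ^+ (k + 2) / (k + 2)`!%:R)%:E) xpredT).
        by move=> k w _ _; rewrite lee_fin divr_ge0// exprn_ge0.
      move=> k _; apply/measurable_EFinP; apply: measurable_funM => //.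
      by apply: measurable_funX; exact: measurableT_comp.
    - by move=> w _; exact: expR_taylor2_le.
  rewrite integral_nneseries//; last first.
    move=> k; apply/measurable_EFinP; apply: measurable_funM => //.
    by apply: measurable_funX; exact: measurableT_comp.
  apply: lime_le.
    apply: is_cvg_nneseries => k _ _; apply: integral_ge0 => w _.
    by rewrite lee_fin divr_ge0// exprn_ge0.
  near=> n.
  apply: (@le_trans _ _ (\sum_(0 <= k < n) ((`|l| * K) ^+ (k + 2))%:E)%E).
    apply: lee_sum => k _.
    have f0 : 0 < (k + 2)`!%:R :> R by rewrite ltr0n fact_gt0.
    under eq_integral do rewrite normrM exprMn mulrAC EFinM.
    rewrite ge0_integralZl//; last first.
      by apply/measurable_EFinP; apply: measurable_funX; exact: measurableT_comp.
    have k2 : (0 < k + 2)%N by rewrite addn2.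
    apply: (le_trans (lee_wpmul2l _ (mom _ k2))).
      by rewrite lee_fin divr_ge0// exprn_ge0.
    rewrite -EFinM lee_fin exprMn mulrA divfK// gt_eqF//.
  rewrite sumEFin lee_fin exprMn -(real_normK (num_real l)) -exprMn.
  by apply: geometric_tail_le; rewrite lK andbT mulr_ge0.
have inth : P.-integrable setT (EFin \o h).
  apply/integrableP; split; first exact/measurable_EFinP.
  under eq_integral do rewrite /= ger0_norm//.
  by apply: le_lt_trans ih _; rewrite ltry.
have intl : P.-integrable setT (fun w => (1 + l * W w)%:E).
  apply: (eq_integrable _ (fun w => 1 + l%:E * (W w)%:E)%E) => //.
  apply: integrableD => //; first exact: finite_measure_integrable_cst.
  exact: integrableZl.
have expE w : (expR (l * (W w - m)))%:E =
    ((expR (- (l * m)))%:E * ((h w)%:E + (1 + l * W w)%:E))%E.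
  rewrite -EFinD -EFinM mulrBr addrC expRD; congr (_ * _)%:E.
  by rewrite /h; ring.
under eq_integral do rewrite expE.
rewrite integralZl//; last exact: integrableD.
rewrite integralD//.
have -> : (\int[P]_w (1 + l * W w)%:E = (1 + l * m)%:E)%E.
  under eq_integral do rewrite EFinD EFinM.
  rewrite integralD//; last 2 first.
  - exact: finite_measure_integrable_cst.
  - exact: integrableZl.
  by rewrite integral_cst//= probability_setT mule1 integralZl// Wm.
apply: (@le_trans _ _ ((expR (- (l * m)))%:E * ((2 * (l * K) ^+ 2)%:E + (1 + l * m)%:E))%E).
  by apply: lee_wpmul2l; [rewrite lee_fin expR_ge0|exact: leeD].
rewrite -EFinD -EFinM lee_fin expRN mulrC ler_pdivrMr ?expR_gt0//.
rewrite -expRD.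
by apply: le_trans (expR_ge1Dx _); lra.
Unshelve. all: by end_near. Qed.

End bernstein.

(** * Deviations of empirical second moments *)

Section tails.
Context {disp : measure_display} {T : measurableType disp} {R : realType}
  (P : probability T R).

(** The exponential Markov inequality, applied to the sum of the independent
variables [f (W i) - m]. *)
Lemma bernstein_tail d' (T' : measurableType d') n (W : 'I_n -> T -> T')
    (f : T' -> R) (K m l t : R) :
  iid P W -> measurable_fun setT f -> 0 <= K ->
  (forall i k, (0 < k)%N ->
    \int[P]_w (`|f (W i w)| ^+ k)%:E <= (k`!%:R * K ^+ k)%:E)%E ->
  (forall i, \int[P]_w (f (W i w))%:E = m%:E)%E ->
  0 <= l -> l * K <= 1 / 2 ->
  (P [set w | (t *+ n <= \sum_i (f (W i w) - m))%R] <=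
   (expR ((2 * (l * K) ^+ 2 - l * t) *+ n))%:E)%E.
Proof.
move=> [mW indW _] mf K0 mom mean l0 lK.
have mfW i : measurable_fun setT (fun w => f (W i w)) by exact: measurableT_comp.
have mgf i : (\int[P]_w (expR (l * (f (W i w) - m)))%:E
    <= (expR (2 * (l * K) ^+ 2))%:E)%E.
  by apply: bernstein_mgf => //; [exact: mom|rewrite ger0_norm].
pose c i := fine (\int[P]_w (expR (l * (f (W i w) - m)))%:E)%E.
have int_ge0 i : (0 <= \int[P]_w (expR (l * (f (W i w) - m)))%:E)%E.
  by apply: integral_ge0 => w _; rewrite lee_fin expR_ge0.
have cE i : (\int[P]_w (expR (l * (f (W i w) - m)))%:E = (c i)%:E)%E.
  rewrite fineK// ge0_fin_numE//.
  by apply: le_lt_trans (mgf i) _; rewrite ltry.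
have mexp : measurable_fun setT (fun v => expR (l * (f v - m))).
  apply: measurableT_comp => //; apply: measurable_funM => //.
  exact: measurable_funB.
have mS : measurable_fun setT (fun w => \sum_i (f (W i w) - m)).
  by apply: measurable_sum => i; exact: measurable_funB.
set A := [set w | _].
have mA : measurable A.
  rewrite (_ : A = (fun w => \sum_i (f (W i w) - m)) @^-1` `[t *+ n, +oo[%classic).
    by rewrite -[X in measurable X]setTI; exact: mS.
  by apply/seteqP; split => w /=; rewrite in_itv/= andbT.
have := integral_prod_independent mW indW (fun=> mexp)
  (fun _ _ => expR_ge0 _) cE.
set E := (\int[P]_w _)%E => EE.
apply: (@le_trans _ _ ((expR (- (l * t *+ n)))%:E * E)%E).
  rewrite -(setIT A) -integral_indic// /E -ge0_integralZl//; last 2 first.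
  - apply/measurable_EFinP.
    apply: (@measurable_prod _ _ _ _ _ _ (fun i w => expR (l * (f (W i w) - m)))) => i _.
    exact: (measurableT_comp mexp).
  - by move=> w _; rewrite lee_fin prodr_ge0// => i _; exact: expR_ge0.
  apply: ge0_le_integral => //.
  - exact/measurable_EFinP/measurable_indic.
  - apply: measurable_funeM; apply/measurable_EFinP.
    apply: (@measurable_prod _ _ _ _ _ _ (fun i w => expR (l * (f (W i w) - m)))) => i _.
    exact: (measurableT_comp mexp).
  - move=> w _; rewrite -EFinM lee_fin -expR_sum -mulr_sumr -expRD.
    rewrite indicE; case: (boolP (w \in A)) => [|_]; last by rewrite expR_ge0.
    rewrite inE/= => wA; rewrite -expR0 ler_expR addrC subr_ge0 -mulrnAr.
    exact: ler_wpM2l.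
rewrite EE -EFinM lee_fin mulrnBl expRD mulrC expRN.
rewrite -expRN ler_wpM2r ?expR_ge0//.
rewrite -(mulr_natl _ n) expRM_natl -[X in _ ^+ X]card_ord -prodr_const.
apply: ler_prod => i _; rewrite -!lee_fin -cE int_ge0/=.
exact: mgf.
Qed.

(** The constant [K] such that the products of two entries of a row of a
sub-Gaussian matrix have moments of order [q] at most [q! K^q]. *)
Definition subexp_scale (s2 : R) := 2 * expR 1 * s2.

Lemma sub_gaussian_matrix_measurable n m (A : T -> 'M[R]_(n, m)) Sigma s2 i k :
  sub_gaussian_matrix P A Sigma s2 -> measurable_fun setT (fun w => A w i k).
Proof.
move=> [[mA _ _] _ _ _].
have /measurable_fun_tnthP/(_ k) := mA i.
by congr measurable_fun; apply/funext => w /=; rewrite tnth_mktuple.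
Qed.

(** An entry is the inner product of its row with a unit coordinate vector. *)
Lemma sub_gaussian_matrix_mgf n m (A : T -> 'M[R]_(n, m)) Sigma s2 i k t :
  sub_gaussian_matrix P A Sigma s2 ->
  (\int[P]_w (expR (t * A w i k))%:E <= (expR (s2 * t ^+ 2 / 2))%:E)%E.
Proof.
move=> [_ EA _ sg].
have unit_delta : l2norm (delta_mx k 0 : 'cV[R]_m) = 1.
  rewrite /l2norm (bigD1 k)//= mxE !eqxx/= expr1n big1 ?addr0 ?sqrtr1// => j jk.
  by rewrite mxE (negPf jk) expr0n.
have [s ss2 [_ sgs]] := sg i _ unit_delta.
have E w : (A w *m delta_mx k 0) i 0 = A w i k.
  rewrite mxE (bigD1 k)//= mxE !eqxx mulr1 big1 ?addr0// => j jk.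
  by rewrite mxE (negPf jk) mulr0.
move: (sgs t); rewrite unlock.
under [X in fine X]eq_integral do rewrite E.
have := EA i k; rewrite unlock => ->.
under eq_integral do rewrite E subr0.
move=> /le_trans; apply; rewrite lee_fin ler_expR ler_wpM2r// ler_wpM2r//.
exact: sqr_ge0.
Qed.

Lemma sub_gaussian_matrix_moment n m (A : T -> 'M[R]_(n, m)) Sigma s2 i k l q :
  sub_gaussian_matrix P A Sigma s2 -> 0 < s2 -> (0 < q)%N ->
  (\int[P]_w (`|A w i k * A w i l| ^+ q)%:E <=
   (q`!%:R * subexp_scale s2 ^+ q)%:E)%E.
Proof.
move=> sgA s20 q0.
have mA j := sub_gaussian_matrix_measurable i j sgA.
apply: moment_mul_le => //; apply: sub_gaussian_even_moment => //.
  by move=> t; exact: sub_gaussian_matrix_mgf sgA.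
by move=> t; exact: sub_gaussian_matrix_mgf sgA.
Qed.

Lemma sub_gaussian_matrix_cov n m (A : T -> 'M[R]_(n, m)) Sigma s2 i k l :
  sub_gaussian_matrix P A Sigma s2 ->
  (\int[P]_w (A w i k * A w i l)%:E = (Sigma k l)%:E)%E.
Proof.
move=> [_ EA covA _]; rewrite -(covA i) covariance.unlock !EA expectation.unlock.
apply: eq_integral => w _; congr EFin.
by rewrite -[RHS]/((A w i k - 0) * (A w i l - 0)) !subr0.
Qed.

Lemma sub_gaussian_matrix_cov_le n m (A : T -> 'M[R]_(n, m)) Sigma s2 (i : 'I_n) k :
  sub_gaussian_matrix P A Sigma s2 -> 0 < s2 -> Sigma k k <= subexp_scale s2.
Proof.
move=> sgA s20; rewrite -lee_fin -(sub_gaussian_matrix_cov i k k sgA).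
have := sub_gaussian_matrix_moment i k k sgA s20 (ltn0Sn 0).
rewrite expr1 mul1r; apply: le_trans.
by under [leRHS]eq_integral do rewrite expr1 ger0_norm -?expr2 ?sqr_ge0// expr2.
Qed.

(** The two one-sided deviations of the empirical second moment are tails of the
sums of [f] and of [- f], for the same product [f] of two coordinates. *)
Lemma gram_tail n m (A : T -> 'M[R]_(n, m)) Sigma s2 k l (lam t : R) :
  sub_gaussian_matrix P A Sigma s2 -> 0 < s2 -> (0 < n)%N ->
  0 <= lam -> lam * subexp_scale s2 <= 1 / 2 ->
  (P [set w | (t <= `|n%:R^-1 * \sum_i A w i k * A w i l - Sigma k l|)%R] <=
   (2 * expR ((2 * (lam * subexp_scale s2) ^+ 2 - lam * t) *+ n))%:E)%E.
Proof.
move=> sgA s20 n0 lam0 lamK.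
have mA i j := sub_gaussian_matrix_measurable i j sgA.
have K0 : 0 <= subexp_scale s2 by rewrite /subexp_scale !mulr_ge0 ?expR_ge0// ltW.
pose W i w := [tuple A w i k | k < m].
have iidW : iid P W by case: sgA.
have side (f : m.-tuple R -> R) c : measurable_fun setT f ->
    (forall i w, `|f (W i w)| = `|A w i k * A w i l|) ->
    (forall i, \int[P]_w (f (W i w))%:E = c%:E)%E ->
    (P [set w | (t *+ n <= \sum_i (f (W i w) - c))%R] <=
      (expR ((2 * (lam * subexp_scale s2) ^+ 2 - lam * t) *+ n))%:E)%E.
  move=> mf fE Ef; apply: bernstein_tail => // i q q0.
  under eq_integral do rewrite fE.
  exact: sub_gaussian_matrix_moment sgA _ _.
pose f (v : m.-tuple R) := tnth v k * tnth v l.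
have mf : measurable_fun setT f.
  by apply: measurable_funM; exact: measurable_tnth.
have fW i w : f (W i w) = A w i k * A w i l by rewrite /f !tnth_mktuple.
have Up := side f (Sigma k l) mf.
have Lo := side (fun v => - f v) (- Sigma k l).
have mS (g : m.-tuple R -> R) c : measurable_fun setT g ->
    measurable [set w | t *+ n <= \sum_i (g (W i w) - c)].
  move=> mg.
  have mS : measurable_fun setT (fun w => \sum_i (g (W i w) - c)).
    apply: measurable_sum => i; apply: measurable_funB => //.
    by apply: measurableT_comp => //; case: iidW.
  rewrite (_ : mkset _ = (fun w => \sum_i (g (W i w) - c)) @^-1` `[t *+ n, +oo[%classic).
    by rewrite -[X in measurable X]setTI; exact: mS.
  by apply/seteqP; split => w /=; rewrite in_itv/= andbT.
have mNf : measurable_fun setT (fun v => - f v) by exact: measurableT_comp.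
have nR : 0 < n%:R :> R by rewrite ltr0n.
have cover : [set w | (t <= `|n%:R^-1 * \sum_i A w i k * A w i l - Sigma k l|)%R]
   = [set w | t *+ n <= \sum_i (f (W i w) - Sigma k l)] `|`
     [set w | t *+ n <= \sum_i (- f (W i w) - - Sigma k l)].
  have E w : \sum_i (f (W i w) - Sigma k l) =
      (n%:R^-1 * \sum_i A w i k * A w i l - Sigma k l) * n%:R.
    rewrite sumrB sumr_const card_ord mulrBl mulrAC mulVf ?gt_eqF// mul1r.
    by rewrite mulr_natr; congr (_ - _); apply: eq_bigr => i _; rewrite fW.
  have E' w : \sum_i (- f (W i w) - - Sigma k l) = - \sum_i (f (W i w) - Sigma k l).
    by rewrite -sumrN; apply: eq_bigr => i _; rewrite opprB opprK addrC.
  apply/seteqP; split => w /=; rewrite E' E -mulNr -(mulr_natr t n) !ler_pM2r//.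
    by rewrite ler_normr => /orP.
  by move=> h; rewrite ler_normr; apply/orP.
rewrite cover; apply: (le_trans (measureU2 _ _ _)).
- exact: mS mf.
- exact: mS mNf.
rewrite mulr_natl mulr2n EFinD; apply: leeD.
  apply: Up => [i w|i]; first by rewrite fW.
  by under eq_integral do rewrite fW; exact: sub_gaussian_matrix_cov sgA.
apply: Lo => // [i w|i]; first by rewrite normrN fW.
under eq_integral do rewrite fW EFinN.
rewrite integralN/=; first by rewrite (sub_gaussian_matrix_cov i k l sgA).
apply: integrable_add_def => //; apply/integrableP; split.
  by apply/measurable_EFinP; exact: measurable_funM.
apply: le_lt_trans (ltry (1`!%:R * subexp_scale s2 ^+ 1)).
apply: le_trans (sub_gaussian_matrix_moment i k l sgA s20 (ltn0Sn 0)).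
by under [leRHS]eq_integral do rewrite expr1.
Qed.

End tails.

Section probabilistic.
Context {disp : measure_display} {T : measurableType disp} {R : realType}
  (P : probability T R).

Lemma union_bound (I : finType) (F : I -> set T) (b : R) :
  (forall i, measurable (F i)) -> (forall i, (P (F i) <= b%:E)%E) ->
  exists B, [/\ measurable B, (P B <= (#|I|%:R * b)%:E)%E &
    forall i, F i `<=` B].
Proof.
move=> mF Fb.
suff H (r : seq I) : exists B, [/\ measurable B, (P B <= ((size r)%:R * b)%:E)%E &
    forall i, i \in r -> F i `<=` B].
  have [B [mB PB FB]] := H (enum I); exists B; rewrite cardE; split => // i.
  by apply: FB; rewrite mem_enum.
elim: r => [|i r [B [mB PB FB]]].
  by exists set0; split => //; rewrite measure0 mul0r.
exists (F i `|` B); split; first exact: measurableU.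
  apply: le_trans (measureU2 _ (mF i) mB) _.
  by rewrite /= -addn1 natrD mulrDl mul1r addrC EFinD; apply: leeD.
move=> j; rewrite inE => /orP[/eqP ->|jr]; first exact: subsetUl.
by apply: subset_trans (FB j jr) _; exact: subsetUr.
Qed.

Lemma sub_gaussian_matrix_le n m (A : T -> 'M[R]_(n, m)) Sigma s2 s2' :
  s2 <= s2' -> sub_gaussian_matrix P A Sigma s2 -> sub_gaussian_matrix P A Sigma s2'.
Proof.
move=> ss' [iidA EA covA sg]; split=> // i u u1.
by have [s ss sgs] := sg i u u1; exists s => //; exact: le_trans ss'.
Qed.

(** The proxy [s2 = 0] is covered by passing to the limit in the bound for positive
proxies. *)
Lemma sub_gaussian_matrix_diag_le n m (A : T -> 'M[R]_(n, m)) Sigma s2 (i : 'I_n) k :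
  sub_gaussian_matrix P A Sigma s2 -> 0 <= s2 -> Sigma k k <= subexp_scale s2.
Proof.
move=> sgA s20; apply/ler_addgt0Pr => eps eps0.
pose x := eps / (2 * expR 1).
have x0 : 0 < x by rewrite divr_gt0// mulr_gt0// expR_gt0.
rewrite (_ : _ + eps = subexp_scale (s2 + x)).
  apply: (sub_gaussian_matrix_cov_le i) => //; last by rewrite ltr_wpDl.
  by apply: sub_gaussian_matrix_le sgA; rewrite lerDl ltW.
by rewrite /subexp_scale /x; field; rewrite gt_eqF ?expR_gt0.
Qed.

Lemma sub_gaussian_matrix_cov_sym n m (A : T -> 'M[R]_(n, m)) Sigma s2 (i : 'I_n) :
  sub_gaussian_matrix P A Sigma s2 -> Sigma^T = Sigma.
Proof.
move=> sgA; apply/matrixP => k l; rewrite mxE; apply: EFin_inj.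
rewrite -!(sub_gaussian_matrix_cov i _ _ sgA).
by under eq_integral do rewrite mulrC.
Qed.

(** With [th = sqrt cn / 2], this is the solution [tau] of
[th tau - 2 th^2 = 4]: the exponent in [gram_uniform_deviation] is
[- (th tau - 2 th^2) L]. *)
Definition deviation_const (cn : R) := (4 + 2 * (Num.sqrt cn / 2) ^+ 2) / (Num.sqrt cn / 2).

(** In [gram_tail], take the exponential parameter [th delta / K] and the deviation
[tau K delta], where [delta = sqrt (L / n)]: the assumption [cn * L <= n] gives
[th delta <= 1 / 2], and each entry deviates with probability at most
[2 exp (- 4 L)]. *)
Lemma gram_uniform_deviation n m (A : T -> 'M[R]_(n, m)) Sigma s2 (cn L : R) :
  sub_gaussian_matrix P A Sigma s2 -> 0 < s2 -> (0 < n)%N ->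
  0 < cn -> 0 <= L -> cn * L <= n%:R ->
  exists B, [/\ measurable B,
    (P B <= ((m ^ 2)%:R * (2 * expR (- (4 * L))))%:E)%E &
    forall w, ~ B w -> forall k l,
      `|n%:R^-1 * \sum_i A w i k * A w i l - Sigma k l| <=
      deviation_const cn * subexp_scale s2 * Num.sqrt (L / n%:R)].
Proof.
move=> sgA s20 n0 cn0 L0 cnL.
have mA i j := sub_gaussian_matrix_measurable i j sgA.
have nR : 0 < n%:R :> R by rewrite ltr0n.
set delta := Num.sqrt (L / n%:R); pose th := Num.sqrt cn / 2.
set K := subexp_scale s2; set tau := deviation_const cn.
have K0 : 0 < K by rewrite /K /subexp_scale !mulr_gt0// expR_gt0.
have th0 : 0 < th by rewrite divr_gt0// sqrtr_gt0.
have d0 : 0 <= delta by rewrite sqrtr_ge0.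
have d2 : delta ^+ 2 = L / n%:R by rewrite sqr_sqrtr// divr_ge0// ltW.
have thd : th * delta <= 1 / 2.
  rewrite /th mulrAC -sqrtrM ?(ltW cn0)// ler_pM2r ?invr_gt0//.
  rewrite -[leRHS]sqrtr1 ler_sqrt// mulrA ler_pdivrMr// mul1r//.
pose t := tau * K * delta; pose lam := th * delta / K.
pose F (kl : 'I_m * 'I_m) :=
  [set w | t <= `|n%:R^-1 * \sum_i A w i kl.1 * A w i kl.2 - Sigma kl.1 kl.2|].
have mF kl : measurable (F kl).
  have mg : measurable_fun setT
      (fun w => `|n%:R^-1 * \sum_i A w i kl.1 * A w i kl.2 - Sigma kl.1 kl.2|).
    apply: measurableT_comp => //; apply: measurable_funB => //.
    apply: measurable_funM => //; apply: measurable_sum => i.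
    exact: measurable_funM.
  rewrite (_ : F kl = (fun w => `|n%:R^-1 * \sum_i A w i kl.1 * A w i kl.2 - Sigma kl.1 kl.2|)
     @^-1` `[t, +oo[%classic).
    by rewrite -[X in measurable X]setTI; exact: mg.
  by apply/seteqP; split => w /=; rewrite in_itv/= andbT.
have PF kl : (P (F kl) <= (2 * expR (- (4 * L)))%:E)%E.
  have lamK : lam * K = th * delta by rewrite /lam divfK// gt_eqF.
  have := gram_tail kl.1 kl.2 t sgA s20 n0.
  move=> /(_ lam); rewrite -/K lamK => /(_ _ thd).
  have -> : (2 * (th * delta) ^+ 2 - lam * t) *+ n = - (4 * L).
    rewrite -mulr_natr /t (_ : lam * _ = th * tau * delta ^+ 2); last first.
      by rewrite /lam; field; rewrite gt_eqF.
    rewrite exprMn d2 /tau /deviation_const -/th; field.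
    by rewrite !gt_eqF.
  by apply; rewrite /lam divr_ge0 ?mulr_ge0// ltW.
have [B [mB PB FB]] := union_bound mF PF.
exists B; split => //; first by rewrite -mulnn -{1 2}(card_ord m) -card_prod.
move=> w nB k l; rewrite leNgt; apply/negP => /ltW h.
by apply: nB; apply: (FB (k, l)).
Qed.

Lemma measurable_bigmaxr (I : Type) (r : seq I) (f : I -> T -> R) :
  (forall i, measurable_fun setT (f i)) ->
  measurable_fun setT (fun w => \big[Num.max/0]_(i <- r) f i w).
Proof.
move=> mf; elim: r => [|i r IH].
  by under eq_fun do rewrite big_nil; exact: measurable_cst.
under eq_fun do rewrite big_cons.
exact: measurable_maxr.
Qed.

End probabilistic.

(** * The smallest eigenvalue of a symmetric matrix *)

Section lambda_min.
Context {R : realType}.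

Definition quad m (A : 'M[R]_m) (v : 'cV[R]_m) : R := (v^T *m A *m v) 0 0.

Lemma quadE m (A : 'M[R]_m) v : quad A v = \sum_k \sum_l A k l * (v k 0 * v l 0).
Proof.
rewrite /quad mxE exchange_big; apply: eq_bigr => l _.
rewrite mxE big_distrl; apply: eq_bigr => k _ /=.
by rewrite mxE; ring.
Qed.

Lemma sqr_l2norm m (v : 'cV[R]_m) : l2norm v ^+ 2 = \sum_k v k 0 ^+ 2.
Proof. by rewrite sqr_sqrtr// sumr_ge0// => k _; rewrite sqr_ge0. Qed.

Lemma sqr_l2normE m (v : 'cV[R]_m) : l2norm v ^+ 2 = (v^T *m v) 0 0.
Proof.
by rewrite sqr_l2norm mxE; apply: eq_bigr => k _; rewrite mxE expr2.
Qed.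

Lemma normM_le_sqr_l2norm m (v : 'cV[R]_m) k l : `|v k 0 * v l 0| <= l2norm v ^+ 2.
Proof.
have le1 j : `|v j 0| ^+ 2 <= l2norm v ^+ 2.
  rewrite real_normK ?num_real// sqr_l2norm (bigD1 j)//= lerDl.
  by rewrite sumr_ge0// => i _; rewrite sqr_ge0.
rewrite normrM; have := le1 k; have := le1 l.
have := sqr_ge0 (`|v k 0| - `|v l 0|); nra.
Qed.

Lemma norm_quad_le m (A : 'M[R]_m) v :
  `|quad A v| <= (\sum_k \sum_l `|A k l|) * l2norm v ^+ 2.
Proof.
rewrite quadE mulr_suml (le_trans (ler_norm_sum _ _ _))// ler_sum// => k _.
rewrite mulr_suml (le_trans (ler_norm_sum _ _ _))// ler_sum// => l _.
by rewrite normrM ler_wpM2l// normM_le_sqr_l2norm.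
Qed.

Lemma quad_sub_scalar m (A : 'M[R]_m) a v :
  quad (A - a%:M) v = quad A v - a * l2norm v ^+ 2.
Proof.
rewrite /quad mulmxBr mulmxBl mul_mx_scalar -scalemxAl sqr_l2normE.
by rewrite mxE [in X in _ + X]mxE [in X in _ - X]mxE.
Qed.

(** With [y = B^-1 v], expanding [0 <= quad B (v - t y)] gives
[quad B v >= 2 t |v|^2 - t^2 quad B^-1 v], and [quad B^-1 v <= K |v|^2] for some
[K]; the choice [t = K^-1] leaves [quad B v >= |v|^2 / K]. *)
Lemma psd_unit_quad_ge m (B : 'M[R]_m) : B^T = B -> B \in unitmx ->
  (forall v, 0 <= quad B v) -> exists2 c, 0 < c & forall v, c * l2norm v ^+ 2 <= quad B v.
Proof.
move=> Bs Bu psd; pose K := 1 + \sum_k \sum_l `|invmx B k l|.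
have K0 : 0 < K.
  by rewrite ltr_pwDl// sumr_ge0// => k _; rewrite sumr_ge0.
exists K^-1; first by rewrite invr_gt0.
move=> v; pose y := invmx B *m v; pose t := K^-1.
have := psd (v - t *: y).
have -> : quad B (v - t *: y) = quad B v - 2 * t * l2norm v ^+ 2 + t ^+ 2 * quad (invmx B) v.
  have By : B *m y = v by rewrite mulKVmx.
  have yB : y^T *m B = v^T by rewrite -{1}Bs -trmx_mul By.
  have tE : (v - t *: y)^T = v^T - t *: y^T by apply/matrixP => a b; rewrite !mxE.
  rewrite /quad tE !mulmxBl !mulmxBr -!scalemxAl -!scalemxAr.
  rewrite yB -(mulmxA v^T B y) By.
  rewrite sqr_l2normE (_ : v^T *m y = v^T *m invmx B *m v); last by rewrite mulmxA.
  set a := v^T *m v; set b := v^T *m B *m v; set e := _ *m v.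
  by rewrite !mxE; ring.
have := ler_norm (quad (invmx B) v); have := norm_quad_le (invmx B) v.
set N := l2norm v ^+ 2; set S := \sum_k _ => h1 h2 h3.
have N0 : 0 <= N by rewrite sqr_ge0.
have h : quad (invmx B) v <= K * N.
  apply: le_trans h2 (le_trans h1 _); rewrite /K -/S; nra.
have : t ^+ 2 * quad (invmx B) v <= t * N.
  have -> : t * N = t ^+ 2 * (K * N) by rewrite /t; field; rewrite gt_eqF.
  by rewrite ler_wpM2l// sqr_ge0.
rewrite -/t; lra.
Qed.

(** Let [s] be the largest number such that [A - s I] is positive semidefinite.
If [A - s I] were invertible it would be bounded below by a positive multiple of
the identity, and [s] could be increased; so [s] is an eigenvalue.  It is the
smallest one, because a quadratic form takes the value [a |v|^2] at an
eigenvector [v] for [a]. *)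
Lemma lambda_min_le_quad m (A : 'M[R]_m) (v : 'cV[R]_m) : A^T = A ->
  lambda_min A * l2norm v ^+ 2 <= quad A v.
Proof.
move=> As; case: m A As v => [|m] A As v.
  by rewrite quadE sqr_l2norm !big_ord0 mulr0.
pose S := [set a | forall v, a * l2norm v ^+ 2 <= quad A v].
have e0 : l2norm (delta_mx 0 0 : 'cV[R]_m.+1) ^+ 2 = 1.
  rewrite sqr_l2norm (bigD1 0)//= mxE !eqxx/= expr1n big1 ?addr0// => j j0.
  by rewrite mxE (negPf j0) expr0n.
have supS : has_sup S.
  split.
    exists (- \sum_k \sum_l `|A k l|) => u /=.
    have := norm_quad_le A u; rewrite ler_norml => /andP[+ _].
    by rewrite mulNr.
  by exists (quad A (delta_mx 0 0)) => a /(_ (delta_mx 0 0)); rewrite e0 mulr1.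
set s := sup S.
have sS u : s * l2norm u ^+ 2 <= quad A u.
  have [u0|u0] := eqVneq (l2norm u ^+ 2) 0.
    have := norm_quad_le A u; rewrite u0 !mulr0 normr_le0 => /eqP ->.
    exact: lexx.
  have up : 0 < l2norm u ^+ 2 by rewrite lt_neqAle eq_sym u0 sqr_ge0.
  rewrite -ler_pdivlMr//; apply: ge_sup => [|a aS]; first by case: supS.
  by rewrite ler_pdivlMr.
have Bs : (A - s%:M)^T = A - s%:M by rewrite raddfB/= As tr_scalar_mx.
have eigs : eigenvalue A s.
  rewrite /eigenvalue /eigenspace kermx_eq0 row_free_unit.
  apply/negP => Bu.
  have [|c c0 cB] := psd_unit_quad_ge Bs Bu.
    by move=> u; rewrite quad_sub_scalar subr_ge0.
  have : s + c <= s.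
    apply: ub_le_sup; first by case: supS.
    by move=> u; have := cB u; rewrite quad_sub_scalar; lra.
  by rewrite gerDl leNgt c0.
apply: le_trans (sS v); rewrite ler_wpM2r ?sqr_ge0//.
apply: ge_inf => //; exists s => a /eigenvalueP[w wA w0].
have := sS w^T; rewrite /quad trmxK wA -scalemxAl mxE.
rewrite sqr_l2normE trmxK ler_pM2r//.
rewrite lt_neqAle; apply/andP; split; last first.
  by rewrite -{1}(trmxK w) -sqr_l2normE sqr_ge0.
apply: contra w0; rewrite eq_sym -{1}(trmxK w) -sqr_l2normE sqr_l2norm.
rewrite psumr_eq0 => [/allP h|k _]; last by rewrite sqr_ge0.
apply/eqP/rowP => k; rewrite mxE; apply/eqP.
by have := h k (mem_index_enum _); rewrite /= mxE sqrf_eq0.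
Qed.

End lambda_min.

(** * Stability of the restricted eigenvalue condition *)

Section deterministic.
Context {R : realType}.

Lemma norm_quad_le_l1norm m (A : 'M[R]_m) rho v :
  (forall k l, `|A k l| <= rho) -> `|quad A v| <= rho * l1norm v ^+ 2.
Proof.
move=> Arho; rewrite quadE expr2 /l1norm mulrCA mulr_suml.
rewrite (le_trans (ler_norm_sum _ _ _))// ler_sum// => k _.
rewrite mulr_sumr mulr_sumr (le_trans (ler_norm_sum _ _ _))// ler_sum// => l _.
by rewrite !normrM [leRHS]mulrCA ler_wpM2r// mulr_ge0.
Qed.

Lemma quad_gram n m (X Y : 'M[R]_(n, m)) c v :
  quad (c *: (X^T *m Y)) v = c * \sum_i (X *m v) i 0 * (Y *m v) i 0.
Proof.
rewrite /quad -scalemxAr -scalemxAl mxE; congr (_ * _).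
rewrite mulmxA -trmx_mul -mulmxA mxE.
by apply: eq_bigr => i _; rewrite mxE.
Qed.

(** The square [|D v|^2] in the expansion of [|(X + D) v|^2] is nonnegative, so only
the cross term has to be bounded; a quadratic form whose coefficients are at most
[rho] in absolute value is at most [rho |v|_1^2]. *)
Lemma restricted_eigenvalue_perturb n m (X D : 'M[R]_(n, m)) Sigma eps rho v :
  (0 < n)%N -> Sigma^T = Sigma ->
  (forall k l, `|n%:R^-1 * \sum_i X i k * X i l - Sigma k l| <= eps) ->
  (forall k l, `|n%:R^-1 * \sum_i X i k * D i l| <= rho) ->
  lambda_min Sigma * l2norm v ^+ 2 - (eps + 2 * rho) * l1norm v ^+ 2 <=
  l2norm ((X + D) *m v) ^+ 2 / n%:R.
Proof.
move=> n0 Ssym Xeps Drho.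
have nR : 0 < n%:R^-1 :> R by rewrite invr_gt0 ltr0n.
have gramE (Y : 'M[R]_(n, m)) k l :
    (n%:R^-1 *: (X^T *m Y)) k l = n%:R^-1 * \sum_i X i k * Y i l.
  by rewrite !mxE; congr (_ * _); apply: eq_bigr => i _; rewrite mxE.
have h1 : `|quad (n%:R^-1 *: (X^T *m X) - Sigma) v| <= eps * l1norm v ^+ 2.
  by apply: norm_quad_le_l1norm => k l; rewrite mxE gramE [in X in _ + X]mxE.
have h2 : `|quad (n%:R^-1 *: (X^T *m D)) v| <= rho * l1norm v ^+ 2.
  by apply: norm_quad_le_l1norm => k l; rewrite gramE.
have h3 := lambda_min_le_quad v Ssym.
have quadB : quad (n%:R^-1 *: (X^T *m X) - Sigma) v =
    quad (n%:R^-1 *: (X^T *m X)) v - quad Sigma v.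
  by rewrite /quad mulmxBr mulmxBl mxE [in X in _ + X]mxE.
have sq : quad (n%:R^-1 *: (X^T *m X)) v + 2 * quad (n%:R^-1 *: (X^T *m D)) v <=
    l2norm ((X + D) *m v) ^+ 2 / n%:R.
  rewrite !quad_gram sqr_l2norm [leRHS]mulrC [2 * _]mulrCA -mulrDr ler_pM2l//.
  rewrite mulr_sumr -big_split/= ler_sum// => i _.
  rewrite mulmxDl [in leRHS]mxE.
  by have := sqr_ge0 ((D *m v) i 0); lra.
move: h1 h2; rewrite quadB !ler_norml => /andP[h1 _] /andP[h2 _]; lra.
Qed.

(** The Cauchy-Schwarz inequality, in the form
[2 |x z| <= (b / a) x^2 + (a / b) z^2] adapted to the two given scales. *)
Lemma cross_moment_le n (x z : 'I_n -> R) (B a b : R) : 0 < a -> 0 < b ->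
  n%:R^-1 * \sum_i x i * x i <= B * a ^+ 2 ->
  n%:R^-1 * \sum_i z i * z i <= B * b ^+ 2 ->
  `|n%:R^-1 * \sum_i x i * z i| <= B * (a * b).
Proof.
move=> a0 b0 xB zB; rewrite normrM ger0_norm ?invr_ge0//.
apply: (@le_trans _ _ (n%:R^-1 * \sum_i (b / (2 * a) * (x i * x i) + a / (2 * b) * (z i * z i)))).
  rewrite ler_wpM2l ?invr_ge0// (le_trans (ler_norm_sum _ _ _))// ler_sum// => i _.
  rewrite -subr_ge0 (_ : _ - _ = (`|x i| * b - `|z i| * a) ^+ 2 / (2 * a * b)).
    by rewrite divr_ge0 ?sqr_ge0// !mulr_ge0// ltW.
  rewrite normrM -!expr2 -(real_normK (num_real (x i))) -(real_normK (num_real (z i))).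
  by field; rewrite !gt_eqF.
rewrite big_split/= -!mulr_sumr mulrDr !(mulrCA n%:R^-1).
have -> : B * (a * b) = b / (2 * a) * (B * a ^+ 2) + a / (2 * b) * (B * b ^+ 2).
  by field; rewrite !gt_eqF.
by apply: lerD; rewrite ler_wpM2l// divr_ge0 ?mulr_ge0// ltW.
Qed.

Lemma lambda_min_le_diag m (A : 'M[R]_m) k : A^T = A -> lambda_min A <= A k k.
Proof.
move=> As; have := lambda_min_le_quad (delta_mx k 0) As.
have dE j : (delta_mx k 0 : 'cV[R]_m) j 0 = (j == k)%:R by rewrite mxE eqxx andbT.
rewrite sqr_l2norm (bigD1 k)//= dE eqxx expr1n big1 ?addr0 ?mulr1; last first.
  by move=> j /negPf jk; rewrite dE jk expr0n.
move=> /le_trans; apply; rewrite quadE (bigD1 k)//= (bigD1 k)//= !dE !eqxx !mulr1.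
rewrite big1 => [|j /negPf jk]; last by rewrite dE jk !mulr0.
rewrite big1 ?addr0// => i /negPf ik; rewrite big1// => j _.
by rewrite dE ik mul0r mulr0.
Qed.

End deterministic.

(** * Measurability of the restricted eigenvalue condition *)

Section measurability.
Context {R : realType}.

Lemma cvg_sumr (I : Type) (r : seq I) (u : I -> R^nat) (l : I -> R) :
  (forall i, u i @ \oo --> l i) ->
  (fun k => \sum_(i <- r) u i k) @ \oo --> \sum_(i <- r) l i.
Proof.
move=> ul; elim: r => [|i r IH].
  by rewrite big_nil; under eq_fun do rewrite big_nil; exact: cvg_cst.
rewrite big_cons; under eq_fun do rewrite big_cons.
exact: cvgD.
Qed.

Lemma cvg_sqr (u : R^nat) (l : R) : u @ \oo --> l -> (fun k => u k ^+ 2) @ \oo --> l ^+ 2.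
Proof. by move=> ul; under eq_fun do rewrite expr2; rewrite expr2; exact: cvgM. Qed.

Lemma rat_approx (x : R) : exists q : nat -> rat, (fun k => ratr (q k) : R) @ \oo --> x.
Proof.
have /choice[q qP] : forall k, exists q : rat, ratr q \in `]x, (x + harmonic k)[.
  by move=> k; apply: rat_in_itvoo; rewrite ltrDl harmonic_gt0.
exists q; apply: (@squeeze_cvgr _ _ _ _ (cst x) (fun k => x + harmonic k)).
- near=> k; have := qP k; rewrite in_itv/= => /andP[h1 h2].
  by rewrite !ltW.
- exact: cvg_cst.
- rewrite -[X in _ --> X]addr0; apply: cvgD; first exact: cvg_cst.
  exact: cvg_harmonic.
Unshelve. all: by end_near. Qed.

(** Both sides are continuous in [v], and rational vectors are dense. *)
Lemma restricted_eigenvalue_ratP n m (M : 'M[R]_(n, m)) (a b c : R) :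
  (forall v : 'cV[R]_m, a * l2norm v ^+ 2 - b * l1norm v ^+ 2 <=
     l2norm (M *m v) ^+ 2 / c) <->
  (forall q : 'cV[rat]_m, let v := map_mx ratr q in
     a * l2norm v ^+ 2 - b * l1norm v ^+ 2 <= l2norm (M *m v) ^+ 2 / c).
Proof.
split=> [h q|h v]; first exact: h.
have /choice[q qv] := fun k => rat_approx (v k 0).
pose u N : 'cV[R]_m := map_mx ratr (\col_k q k N).
have uv k : (fun N => u N k 0) @ \oo --> v k 0.
  by under eq_fun do rewrite !mxE; exact: qv.
have l2 : (fun N => l2norm (u N) ^+ 2) @ \oo --> l2norm v ^+ 2.
  rewrite sqr_l2norm; under eq_fun do rewrite sqr_l2norm.
  by apply: cvg_sumr => k; exact: cvg_sqr.
have l1 : (fun N => l1norm (u N) ^+ 2) @ \oo --> l1norm v ^+ 2.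
  by apply: cvg_sqr; apply: cvg_sumr => k; exact: cvg_norm.
have lM : (fun N => l2norm (M *m u N) ^+ 2) @ \oo --> l2norm (M *m v) ^+ 2.
  rewrite sqr_l2norm; under eq_fun do rewrite sqr_l2norm.
  apply: cvg_sumr => i; apply: cvg_sqr; rewrite mxE; under eq_fun do rewrite mxE.
  by apply: cvg_sumr => k; apply: cvgM; [exact: cvg_cst|exact: uv].
rewrite -subr_ge0.
have lim : (fun N => l2norm (M *m u N) ^+ 2 / c
      - (a * l2norm (u N) ^+ 2 - b * l1norm (u N) ^+ 2)) @ \oo -->
    l2norm (M *m v) ^+ 2 / c - (a * l2norm v ^+ 2 - b * l1norm v ^+ 2).
  apply: cvgB; first by apply: cvgM => //; exact: cvg_cst.
  by apply: cvgB; apply: cvgM => //; exact: cvg_cst.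
apply: (cvgr_to_ge lim).
by apply: nearW => N; rewrite subr_ge0; exact: h.
Qed.

Context {disp : measure_display} {T : measurableType disp}.

Lemma measurable_restricted_eigenvalue n m (M : T -> 'M[R]_(n, m)) (a b c : R) :
  (forall i j, measurable_fun setT (fun w => M w i j)) ->
  measurable [set w | forall v : 'cV[R]_m, a * l2norm v ^+ 2 - b * l1norm v ^+ 2 <=
     l2norm (M w *m v) ^+ 2 / c].
Proof.
move=> mM.
pose S (q : 'cV[rat]_m) := [set w | let v : 'cV[R]_m := map_mx ratr q in
  a * l2norm v ^+ 2 - b * l1norm v ^+ 2 <= l2norm (M w *m v) ^+ 2 / c].
rewrite (_ : mkset _ =
  \bigcap_(k in [set: nat]) (if unpickle k is Some q then S q else setT)); last first.
  apply/seteqP; split => w /=.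
    move=> /restricted_eigenvalue_ratP h k _.
    by case: unpickle => // q; exact: h.
  move=> h; apply/restricted_eigenvalue_ratP => q.
  by have := h (pickle q) I; rewrite pickleK.
apply: bigcapT_measurable => k; case: unpickle => // q.
set v : 'cV[R]_m := map_mx ratr q.
have mF : measurable_fun setT (fun w => l2norm (M w *m v) ^+ 2 / c).
  apply: measurable_funM => //.
  rewrite (_ : (fun w => _) = (fun w => \sum_i (\sum_j M w i j * v j 0) ^+ 2)).
    apply: measurable_sum => i; apply: measurable_funX.
    by apply: measurable_sum => j; exact: measurable_funM.
  apply/funext => w; rewrite sqr_l2norm; apply: eq_bigr => i _; by rewrite mxE.
rewrite (_ : S q = (fun w => l2norm (M w *m v) ^+ 2 / c) @^-1`
    `[a * l2norm v ^+ 2 - b * l1norm v ^+ 2, +oo[%classic).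
  by rewrite -[X in measurable X]setTI; exact: mF.
by apply/seteqP; split => w /=; rewrite in_itv/= andbT.
Qed.

End measurability.

(** * The fitted regressor matrix *)

Theorem lemma6p1 (R : realType) (c_n c_pi c1_pi c2_pi : R)
    (hc_n : 0 < c_n) (hc_pi : 0 < c_pi) (hc1_pi : 0 < c1_pi)
    (hc2_pi : 0 < c2_pi) :
  exists c c1 c2 : R, [/\ 0 < c, 0 < c1 & 0 < c2] /\
  forall (n p d k1 k2 : nat)
    (disp : measure_display) (T : measurableType disp) (P : probability T R)
    (y : 'I_n -> {RV P >-> R})
    (x : 'I_n -> 'I_p -> {RV P >-> R})
    (z : 'I_n -> 'I_p -> 'I_d -> {RV P >-> R})
    (eps : 'I_n -> {RV P >-> R})
    (eta : 'I_n -> 'I_p -> {RV P >-> R})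
    (betastar : 'cV[R]_p) (pistar : 'I_p -> 'cV[R]_d)
    (pihat : 'I_p -> 'I_d -> {RV P >-> R})
    (SigmaX : 'M[R]_p) (SigmaZ : 'I_p -> 'M[R]_d)
    (s_eps s_eta s_X s_Z : R) (i0 : 'I_n),
  let pihatv (w : T) (j : 'I_p) := \col_l pihat j l w in
  let Xstar := first_stage (fun i j l => z i j l) pistar in
  let Xhat (w : T) := first_stage (fun i j l => z i j l) (pihatv w) w in
  let lamX := lambda_min SigmaX in
  let lamZ := inf (range (fun j => lambda_min (SigmaZ j))) in
  let kappa1 := lamX / 2 in
  let kappa2 := Num.max (b0 lamX s_X)
    (Num.max (b1 lamZ s_X s_Z s_eta (max_Exz P (fun i j l => z i j l) pistar i0))
             (b2 lamZ s_Z s_eta (max_Ezz P (fun i j l => z i j l) i0))) in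
  (* dimensions *)
  (0 < n)%N -> (n <= p)%N -> (n <= d)%N ->
  0 <= s_eps -> 0 <= s_eta -> 0 <= s_X -> 0 <= s_Z ->
  (* triangular simultaneous equations model *)
  (forall i w, y i w = \sum_j x i j w * betastar j 0 + eps i w) ->
  (forall i j w, x i j w = \sum_l z i j l w * pistar j l 0 + eta i j w) ->
  (* centred data *)
  (forall i, ('E_P[y i] = 0)%E) ->
  (forall i j, ('E_P[x i j] = 0)%E) ->
  (forall i j l, ('E_P[z i j l] = 0)%E) ->
  (* (i) *)
  iid P (obs (fun i => y i) (fun i j => x i j) (fun i j l => z i j l)) ->
  (forall i, (y i : T -> R) \in Lfun P 2%:E) ->
  (forall i j, (x i j : T -> R) \in Lfun P 2%:E) ->
  (forall i j l, (z i j l : T -> R) \in Lfun P 2%:E) ->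
  (forall i j l, ('E_P[fun w => (z i j l w * eps i w)%R] = 0)%E) ->
  (forall i j l, ('E_P[fun w => (z i j l w * eta i j w)%R] = 0)%E) ->
  (forall i j j' l, j != j' -> ('E_P[fun w => (z i j l w * eta i j' w)%R] = 0)%E) ->
  (* (ii) *)
  (forall j, (nnz (pistar j) <= k1)%N) ->
  (nnz betastar <= k2)%N ->
  (* (iii) *)
  sub_gaussian_vector P (fun i => eps i) (s_eps ^+ 2) ->
  (forall j, sub_gaussian_vector P (fun i => eta i j) (s_eta ^+ 2)) ->
  (forall j, sub_gaussian_matrix P (Zmx (fun i j l => z i j l) j)
               (SigmaZ j) (s_Z ^+ 2)) ->
  (* (iv) *)
  sub_gaussian_matrix P Xstar SigmaX (s_X ^+ 2) ->
  (* (v) *)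
  ((1 - c1_pi * expR (- (c2_pi * ln (maxn (maxn d p) n)%:R)))%:E <=
   P [set w | (\big[Num.max/0]_(j < p) l1norm (pihatv w j - pistar j) <=
              c_pi * s_eta / lamZ * k1%:R
              * Num.sqrt (ln (maxn d p)%:R / n%:R))%R])%E ->
  (* (vi) *)
  c_n * Num.max (k1%:R ^+ 2 * ln d%:R) (k1%:R ^+ 2 * ln p%:R) <= n%:R ->
  ((1 - c1 * expR (- (c2 * ln (maxn p d)%:R)))%:E <=
   P [set w | forall v0 : 'cV[R]_p,
        (kappa1 * l2norm v0 ^+ 2
        - c * kappa2 * k1%:R * Num.sqrt (ln (maxn p d)%:R / n%:R)
          * l1norm v0 ^+ 2
        <= l2norm (Xhat w *m v0) ^+ 2 / n%:R)%R])%E.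
Proof.
set e := expR 1 : R; have e0 : 0 < e by exact: expR_gt0.
pose tau := deviation_const c_n; pose r := Num.sqrt c_n.
have r0 : 0 < r by rewrite sqrtr_gt0.
have tau0 : 0 < tau.
  by rewrite /tau /deviation_const divr_gt0 ?divr_gt0// addr_gt0// mulr_gt0// exprn_gt0// divr_gt0.
(* [B s^2] bounds the empirical second moments of variables with variance proxy
   [s^2] outside the exceptional events; see [scaleB]. *)
pose B := 2 * e * (1 + tau / r).
have B0 : 0 < B by rewrite !mulr_gt0// addr_gt0// divr_gt0.
pose c := 2 * e * tau + 2 * (B * c_pi).
have c0 : 0 < c by rewrite addr_gt0// mulr_gt0// mulr_gt0.
exists c, (c1_pi + 4), (Num.min c2_pi 1).
split.
  split => //; last by rewrite lt_min hc2_pi ltr01.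
  by rewrite addr_gt0// ltr0n.
move=> n p d k1 k2 disp T P y x z eps eta betastar pistar pihat SigmaX SigmaZ.
move=> s_eps s_eta s_X s_Z i0 pihatv Xstar Xhat lamX lamZ kappa1 kappa2.
move=> n0 np nd _ seta0 sX0 sZ0 _ _ _ _ _ _ _ _ _ _ _ _ pi_sparse _ _ _ sgZ sgX.
move=> Av_prob dim.
set m := maxn p d; set L := ln m%:R; set delta := Num.sqrt (L / n%:R).
have nR : 0 < n%:R :> R by rewrite ltr0n.
have p0 : (0 < p)%N by exact: leq_trans np.
have d0 : (0 < d)%N by exact: leq_trans nd.
pose j0 : 'I_p := Ordinal p0; pose l0 : 'I_d := Ordinal d0.
have m0 : (0 < m)%N by rewrite leq_max p0.
have mR : 1 <= m%:R :> R by rewrite ler1n.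
have L0 : 0 <= L by rewrite ln_ge0.
have delta0 : 0 <= delta by rewrite sqrtr_ge0.
have mz i j l : measurable_fun setT (z i j l : T -> R) by exact: measurable_funPT.
have mpi j l : measurable_fun setT (pihat j l : T -> R) by exact: measurable_funPT.
have mXhat i j : measurable_fun setT (fun w => Xhat w i j).
  rewrite (_ : (fun w => _) = fun w => \sum_l z i j l w * pihat j l w).
    by apply: measurable_sum => l; exact: measurable_funM.
  apply/funext => w; rewrite !mxE; apply: eq_bigr => l _; by rewrite !mxE.
set E := [set w | _].
have mE : measurable E by exact: measurable_restricted_eigenvalue.
have kappa2_ge0 : 0 <= kappa2.
  apply: (@le_trans _ _ (s_eta ^+ 2 * s_Z ^+ 2 / lamZ ^+ 2)).
    by apply: divr_ge0; [apply: mulr_ge0|]; exact: sqr_ge0.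
  by rewrite /kappa2 /b2 !le_max lexx !orbT.
have coef_ge0 : 0 <= c * kappa2 * k1%:R * delta.
  by rewrite !mulr_ge0// ltW.
have [lamX0|lamX0] := leP lamX 0.
  have -> : E = setT.
    apply/seteqP; split => // w _ v /=.
    apply: (@le_trans _ _ 0); last by rewrite divr_ge0 ?sqr_ge0.
    rewrite subr_le0; apply: (@le_trans _ _ 0); last by rewrite mulr_ge0// sqr_ge0.
    by rewrite mulr_le0_ge0 ?sqr_ge0// /kappa1 ler_pdivrMr// mul0r.
  rewrite probability_setT lee_fin gerBl mulr_ge0 ?expR_ge0//.
  by rewrite addr_ge0// ltW.
have symX := sub_gaussian_matrix_cov_sym i0 sgX.
have sX2 : 0 < s_X ^+ 2.
  rewrite lt_neqAle sqr_ge0 andbT; apply/negP => /eqP sX2.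
  have := sub_gaussian_matrix_diag_le i0 j0 sgX; rewrite -sX2 /subexp_scale mulr0.
  move=> /(_ (lexx _)); have := lambda_min_le_diag j0 symX; rewrite -/lamX.
  lra.
have sXp : 0 < s_X by rewrite lt_neqAle sX0 andbT; apply: contraTneq sX2 => <-; rewrite expr0n ltxx.
(* If [k1 = 0] then all the [pistar j] vanish, hence so do [X*] and [SigmaX]. *)
have k1R : 1 <= k1%:R :> R.
  rewrite ler1n lt0n; apply/negP => /eqP k10.
  have pi0 j l : pistar j l 0 = 0.
    have := pi_sparse j; rewrite k10 leqn0 cards_eq0 => /eqP/setP/(_ l).
    by rewrite !inE => /negbFE/eqP.
  have S0 : SigmaX j0 j0 = 0.
    apply: EFin_inj; rewrite -(sub_gaussian_matrix_cov i0 j0 j0 sgX).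
    rewrite -[RHS](@integral0 _ _ _ P setT); apply: eq_integral => w _.
    rewrite (_ : Xstar w i0 j0 = 0) ?mul0r// !mxE big1// => l _.
    by rewrite pi0 mulr0.
  by have := lambda_min_le_diag j0 symX; rewrite S0 -/lamX; lra.
have cnL : c_n * L <= n%:R.
  apply: le_trans dim; rewrite ler_pM2l// le_max.
  have le_sqr (u : R) : 0 <= u -> u <= k1%:R ^+ 2 * u.
    by move=> u0; rewrite ler_peMl// exprn_ege1.
  rewrite /L /m; case: leqP => _; apply/orP; [left|right]; apply: le_sqr;
    by rewrite ln_ge0// ler1n.
have rdelta : r * delta <= 1.
  rewrite /r /delta -sqrtrM ?(ltW hc_n)// -[leRHS]sqrtr1 ler_sqrt// mulrA.
  by rewrite ler_pdivrMr// mul1r.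
have expLm : expR L = m%:R by rewrite lnK// posrE (lt_le_trans ltr01).
(* A second moment of order [K] plus a deviation [tau K delta], where
   [delta <= r^-1]. *)
have scaleB (s : R) : 0 <= s ->
    subexp_scale s + tau * subexp_scale s * delta <= B * s.
  move=> sge0; rewrite -mulrA [_ * delta]mulrC mulrA -{1}[subexp_scale s]mul1r.
  rewrite -mulrDl /B [leRHS]mulrAC [leRHS]mulrC -/(subexp_scale s).
  rewrite ler_wpM2r ?mulr_ge0 ?(ltW e0)// lerD2l ler_wpM2l ?(ltW tau0)//.
  by rewrite -[leRHS]mul1r ler_pdivlMr// mulrC.
have [B1 [mB1 PB1 B1P]] := gram_uniform_deviation sgX sX2 n0 hc_n L0 cnL.
have sZp : 0 < lamZ -> 0 < s_Z.
  move=> lamZ0; rewrite lt_neqAle sZ0 andbT; apply/negP => /eqP sZ00.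
  have := sub_gaussian_matrix_diag_le i0 l0 (sgZ j0).
  rewrite -sZ00 expr0n /subexp_scale mulr0 => /(_ (lexx _)).
  have := lambda_min_le_diag l0 (sub_gaussian_matrix_cov_sym i0 (sgZ j0)).
  have : lamZ <= lambda_min (SigmaZ j0).
    apply: ge_inf; last by exists j0.
    exists (- \sum_j `|lambda_min (SigmaZ j)|) => _ [j _ <-].
    rewrite lerNl; apply: le_trans (ler_norm _) _.
    by rewrite normrN (bigD1 j)//= lerDl sumr_ge0.
  lra.
have [B2 [mB2 PB2 B2P]] : exists B2, [/\ measurable B2,
    (P B2 <= (p%:R * ((d ^ 2)%:R * (2 * expR (- (4 * L)))))%:E)%E &
    forall w, ~ B2 w -> 0 < lamZ -> forall j l,
      n%:R^-1 * \sum_i z i j l w * z i j l w <= B * s_Z ^+ 2].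
  have [lamZ0|lamZ0] := leP lamZ 0.
    exists set0; split => //.
    by rewrite measure0 lee_fin !mulr_ge0 ?expR_ge0.
  have sZ2 : 0 < s_Z ^+ 2 by rewrite exprn_gt0// sZp.
  have /choice[F FP] := fun j => gram_uniform_deviation (sgZ j) sZ2 n0 hc_n L0 cnL.
  have [||B2 [mB2 PB2 FB2]] := @union_bound _ _ _ P _ F
      ((d ^ 2)%:R * (2 * expR (- (4 * L)))).
  - by move=> j; have [] := FP j.
  - by move=> j; have [] := FP j.
  exists B2; split => //; first by rewrite card_ord in PB2.
  move=> w nB _ j l; have [_ _ /(_ w)] := FP j.
  move=> /(_ (fun Fw => nB (FB2 j w Fw)) l l).
  under eq_bigr do rewrite !mxE.
  rewrite ler_norml => /andP[_].
  have := sub_gaussian_matrix_diag_le i0 l (sgZ j) (ltW sZ2).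
  have := scaleB _ (ltW sZ2); rewrite -/tau -/delta.
  lra.
move: Av_prob; rewrite (maxnC d p) -/m.
rewrite (maxn_idPl (leq_trans np (leq_maxl p d))) -/L -/delta.
set Av := [set w | _] => Av_prob.
have mAv : measurable Av.
  have mg : measurable_fun setT
      (fun w => \big[Num.max/0]_(j < p) l1norm (pihatv w j - pistar j)).
    apply: measurable_bigmaxr => j; apply: measurable_sum => l.
    apply: measurableT_comp => //.
    rewrite (_ : (fun w => _) = fun w => pihat j l w - pistar j l 0).
      exact: measurable_funB.
    by apply/funext => w; rewrite !mxE.
  rewrite (_ : Av = (fun w => \big[Num.max/0]_(j < p) l1norm (pihatv w j - pistar j))
     @^-1` `]-oo, c_pi * s_eta / lamZ * k1%:R * delta]%classic).
    by rewrite -[X in measurable X]setTI; exact: mg.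
  by apply/seteqP; split => w; rewrite /Av /= in_itv.
have good : Av `<=` E `|` (B1 `|` B2).
  move=> w Aw; have [B1w|nB1] := pselect (B1 w); first by right; left.
  have [B2w|nB2] := pselect (B2 w); first by right; right.
  left => v /=.
  have pi_l1 j : l1norm (pihatv w j - pistar j) <= c_pi * s_eta / lamZ * k1%:R * delta.
    by apply: le_trans Aw; apply: le_bigmax.
  pose D := Xhat w - Xstar w.
  have XD : Xhat w = Xstar w + D by rewrite addrC subrK.
  pose rho := B * c_pi * kappa2 * k1%:R * delta.
  have Bc0 : 0 <= B * c_pi by apply: mulr_ge0; exact: ltW.
  have et0 : 0 <= 2 * e * tau by apply: mulr_ge0; [apply: mulr_ge0 => //|]; exact: ltW.
  have rho0 : 0 <= rho by do 3 apply: mulr_ge0 => //.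
  have DE i j : D i j = \sum_l z i j l w * (pihatv w j - pistar j) l 0.
    rewrite /D !mxE -sumrB; apply: eq_bigr => l _; by rewrite !mxE mulrBr.
  have cross j j' : `|n%:R^-1 * \sum_i Xstar w i j * D i j'| <= rho.
    have [lamZ0|lamZ0] := leP lamZ 0.
      have h0 : l1norm (pihatv w j' - pistar j') <= 0.
        apply: le_trans (pi_l1 j') _.
        rewrite -!mulrA mulr_ge0_le0 ?(ltW hc_pi)// mulr_ge0_le0//.
        by rewrite mulr_le0_ge0 ?mulr_ge0// invr_le0.
      have h l : (pihatv w j' - pistar j') l 0 = 0.
        apply/eqP; rewrite -normr_le0; apply: le_trans h0.
        by rewrite /l1norm (bigD1 l)//= lerDl sumr_ge0.
      rewrite big1 ?mulr0 ?normr0// => i _; rewrite DE big1 ?mulr0// => l _.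
      by rewrite h mulr0.
    have mom q l : `|n%:R^-1 * \sum_i Xstar w i q * z i j' l w| <= B * (s_X * s_Z).
      apply: cross_moment_le => //; [exact: sZp| |exact: B2P].
      have := B1P w nB1 q q; rewrite ler_norml => /andP[_].
      have := sub_gaussian_matrix_diag_le i0 q sgX (ltW sX2).
      have := scaleB _ (ltW sX2); rewrite -/tau -/delta.
      lra.
    have -> : n%:R^-1 * \sum_i Xstar w i j * D i j' =
        \sum_l (pihatv w j' - pistar j') l 0 * (n%:R^-1 * \sum_i Xstar w i j * z i j' l w).
      under eq_bigr do rewrite DE mulr_sumr.
      rewrite exchange_big mulr_sumr; apply: eq_bigr => l _ /=.
      rewrite mulrCA; congr (_ * _); rewrite mulr_sumr; apply: eq_bigr => i _.
      by rewrite mulrA mulrC.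
    apply: (@le_trans _ _ (l1norm (pihatv w j' - pistar j') * (B * (s_X * s_Z)))).
      rewrite /l1norm mulr_suml (le_trans (ler_norm_sum _ _ _))// ler_sum// => l _.
      by rewrite normrM ler_wpM2l.
    have BX0 : 0 <= B * (s_X * s_Z) by apply: mulr_ge0; [exact: ltW|exact: mulr_ge0].
    apply: (le_trans (ler_wpM2r BX0 (pi_l1 j'))).
    have b1_le : s_eta * s_X * s_Z / lamZ <= kappa2.
      by rewrite /kappa2 /b1 !le_max lexx !orbT.
    rewrite [leLHS](_ : _ = B * c_pi * (s_eta * s_X * s_Z / lamZ) * k1%:R * delta).
      by rewrite /rho !ler_wpM2r// ler_wpM2l.
    by field; rewrite gt_eqF.
  have b0_le : s_X ^+ 2 <= kappa2.
    apply: (@le_trans _ _ (b0 lamX s_X)); last by rewrite /kappa2 le_max lexx.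
    rewrite /b0 (_ : s_X ^+ 4 = (s_X ^+ 2) ^+ 2); last by rewrite -exprM.
    rewrite -expr_div_n.
    rewrite -ler_pdivrMl// mulrC; set q := s_X ^+ 2 / lamX.
    (* [q <= max (q^2) 1], and [b0 = lamX * max (q^2) 1] *)
    rewrite le_max; have [q1|q1] := leP q 1; first by rewrite orbT.
    by rewrite expr2 ler_peMl// ltW// (lt_trans ltr01).
  have epsX k l := B1P w nB1 k l.
  have := restricted_eigenvalue_perturb v n0 symX epsX cross.
  rewrite -XD -/lamX -/tau -/delta => /(le_trans _); apply.
  have N0 : 0 <= l2norm v ^+ 2 by rewrite sqr_ge0.
  have O0 : 0 <= l1norm v ^+ 2 by rewrite sqr_ge0.
  apply: lerB; first by rewrite ler_wpM2r// /kappa1; lra.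
  rewrite ler_wpM2r//.
  have -> : c * kappa2 * k1%:R * delta =
      2 * e * tau * kappa2 * k1%:R * delta + 2 * rho by rewrite /c /rho; ring.
  rewrite lerD2r ler_wpM2r//.
  rewrite /subexp_scale -/e (_ : tau * _ = 2 * e * tau * s_X ^+ 2); last by ring.
  apply: (@le_trans _ _ (2 * e * tau * kappa2)).
    by rewrite ler_wpM2l.
  by rewrite ler_peMr// mulr_ge0.
have PAv : (P Av <= P E + (P B1 + P B2))%E.
  apply: le_trans (le_measure _ _ _ good) _; rewrite ?inE//.
    by apply: measurableU => //; exact: measurableU.
  apply: le_trans (measureU2 _ _ _) _ => //; first exact: measurableU.
  by rewrite leeD2l// measureU2.
have PE : P E \is a fin_num by exact: fin_num_measure.
have m4 : expR (- (4 * L)) = m%:R ^- 4.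
  by rewrite expRN -expLm -expRM_natl.
(* Either family of Gram matrices has at most [m^3] entries, each of which
   deviates with probability at most [2 m^-4]. *)
pose bad := m%:R ^+ 3 * (2 * expR (- (4 * L))).
have PB1' : (P B1 <= bad%:E)%E.
  apply: le_trans PB1 _; rewrite lee_fin ler_wpM2r ?mulr_ge0 ?expR_ge0//.
  rewrite -natrX ler_nat (@leq_trans (m ^ 2))//.
    by rewrite leq_exp2r// leq_maxl.
  by rewrite leq_pexp2l.
have PB2' : (P B2 <= bad%:E)%E.
  apply: le_trans PB2 _; rewrite lee_fin mulrA ler_wpM2r ?mulr_ge0 ?expR_ge0//.
  rewrite -natrX -natrM ler_nat (expnS m 2) leq_mul ?leq_maxl// leq_exp2r//.
  exact: leq_maxr.
have badE : bad = 2 * expR (- L).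
  rewrite /bad m4 expRN expLm; field.
  by rewrite gt_eqF// (lt_le_trans ltr01).
have : ((1 - c1_pi * expR (- (c2_pi * L)))%:E <= P E + (bad + bad)%:E)%E.
  apply: le_trans Av_prob (le_trans PAv _).
  by apply: leeD => //; rewrite EFinD; exact: leeD.
rewrite -(fineK PE) -EFinD !lee_fin badE.
have le1 : expR (- (c2_pi * L)) <= expR (- (Num.min c2_pi 1 * L)).
  by rewrite ler_expR lerN2 ler_wpM2r// ge_min lexx.
have le2 : expR (- L) <= expR (- (Num.min c2_pi 1 * L)).
  by rewrite ler_expR lerN2 -[leRHS]mul1r ler_wpM2r// ge_min lexx orbT.
have := ler_wpM2l (ltW hc1_pi) le1; lra.
Qed.
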